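(* Let $d\ge1$, $m>0$, $\gamma\in\big[0,\frac{d+1}{2}\big)$ and let $f(x)=e^{-m|x|}g(|x|)$, $x\in\mathbb{R}^d$, with $g(r)=r^{-\gamma}$ or $g(r)=(1\vee r)^{-\gamma}$. Set $\rho_1=d-\gamma$ if $g(r)=r^{-\gamma}$, $\rho_1=d$ if $g(r)=(1\vee r)^{-\gamma}$, and $\rho_2=\frac{d+1}{2}-\gamma$. Let $M_2:=(C_1\vee C_2)\|f\|_1$, where $C_1,C_2\ge1$ are constants such that $f(x)\le C_1f(y)$ for $1\le|x|\le|y|\le|x|+1$ and $f(x)\le C_2f(2x)$ for $|x|\le1$. Then there are positive constants $E_1,\dots,E_6$ such that for every $|x|\ge1$ and $\lambda>0$ the following estimates hold. (1) If $\lambda|x|^{\frac{d+1}{2}-\gamma}\le1$, then $$E_1\le\frac{p_\lambda(x)}{\lambda e^{-\lambda\|f\|_1}e^{-m|x|}|x|^{-\gamma}}\le E_2.$$ (2) If $\lambda|x|^{\frac{d+1}{2}-\gamma}\ge1$, then $$E_3\exp\left(E_4\big(\lambda|x|^{\frac{d+1}{2}-\gamma}\big)^{\frac{1}{\rho_1+1}}\right)\le\frac{p_\lambda(x)}{e^{-\lambda\|f\|_1}e^{-m|x|}|x|^{-\frac{d+1}{2}}}\le E_5\,e^{\lambda M_2}\exp\left(E_6\big(\lambda|x|^{\frac{d+1}{2}-\gamma}\big)^{\frac{1}{\rho_2+1}}\right).$$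
   Context: $a\vee b=\max(a,b)$; $|x|$ is the Euclidean norm, $\|f\|_1$ the $L^1(\mathbb{R}^d)$ norm. Constants $C_1,C_2$ as in the claim exist for these $f$. Convolutions: $f^{1\star}:=f$, $f^{n\star}(x):=\int_{\mathbb{R}^d}f(x-y)f^{(n-1)\star}(y)\,dy$ for $n\ge2$. For $\lambda>0$ the density of the compound Poisson measure built for $f$ is $$p_\lambda(x)=e^{-\lambda\|f\|_1}\sum_{n=1}^\infty\frac{\lambda^nf^{n\star}(x)}{n!}.$$ *)

(* Defs.v *)
From HB Require Import structures.
From mathcomp Require Import all_boot all_order all_algebra.
From mathcomp Require Import all_classical all_reals all_analysis.

Set Implicit Arguments.
Unset Strict Implicit.
Unset Printing Implicit Defensive.

Import Order.TTheory GRing.Theory Num.Theory.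
Import numFieldNormedType.Exports.

Local Open Scope classical_set_scope.
Local Open Scope ring_scope.

(* R^d is the type of d-tuples of reals, which the library equips with the
   product (hence Borel) sigma-algebra. *)
Notation Rn R d := (d.-tuple (measurableTypeR R)).

Section lebesgue_succ.
Context {R : realType} {n : nat}.
Variable mu : {sigma_finite_measure set (Rn R n) -> \bar R}.

Let consR (p : measurableTypeR R * Rn R n) : Rn R n.+1 := [tuple of p.1 :: p.2].

Let mconsR : measurable_fun [set: measurableTypeR R * Rn R n] consR.
Proof. exact: measurable_cons. Qed.

Definition lebesgue_succ : set (Rn R n.+1) -> \bar R :=
  pushforward (@lebesgue_measure R \x mu)%E consR.

Let lebesgue_succ0 : lebesgue_succ set0 = 0%E.
Proof. exact: measure0. Qed.

Let lebesgue_succ_ge0 A : (0 <= lebesgue_succ A)%E.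
Proof. exact: measure_ge0. Qed.

Let lebesgue_succ_sigma_additive : semi_sigma_additive lebesgue_succ.
Proof. exact: measure_semi_sigma_additive. Qed.

HB.instance Definition _ := isMeasure.Build _ _ _ lebesgue_succ
  lebesgue_succ0 lebesgue_succ_ge0 lebesgue_succ_sigma_additive.

Let lebesgue_succ_sigma_finite : sigma_finite setT lebesgue_succ.
Proof.
have /sigma_finiteP[F [TF ndF Foo]] := sigma_finiteT (@lebesgue_measure R).
have /sigma_finiteP[G [TG ndG Goo]] := sigma_finiteT mu.
pose tl (t : Rn R n.+1) : Rn R n := [tuple of behead t].
pose H k : set (Rn R n.+1) := [set t | F k (thead t)] `&` (tl @^-1` G k).
exists H.
  apply/esym; rewrite -subTset => t _.
  have [i _ Fi] : (\bigcup_k F k) (thead t) by rewrite -TF.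
  have [j _ Gj] : (\bigcup_k G k) (tl t) by rewrite -TG.
  exists (maxn i j) => //; split => /=.
  - exact: (subsetPset _ _ (ndF _ _ (leq_maxl i j))).
  - exact: (subsetPset _ _ (ndG _ _ (leq_maxr i j))).
move=> k; have [mFk Fkoo] := Foo k; have [mGk Gkoo] := Goo k; split.
  apply: measurableI; rewrite -[X in measurable X]setTI.
  - exact: (@measurable_tnth _ (measurableTypeR R) n.+1 ord0).
  - exact: measurable_behead.
have -> : lebesgue_succ (H k) = (@lebesgue_measure R \x mu)%E (F k `*` G k).
  congr ((_ \x _)%E _); apply/seteqP; split => -[a t];
    rewrite /H /consR/= theadE (_ : tl _ = t)//; exact: val_inj.
by rewrite product_measure1E// lte_mul_pinfty// ge0_fin_numE.
Qed.

HB.instance Definition _ := Measure_isSigmaFinite.Build _ _ _ lebesgue_succ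
  lebesgue_succ_sigma_finite.

End lebesgue_succ.

(* Lebesgue measure on R^d, by recursion on d: the image of the product of the
   Lebesgue measures on R and R^(d-1) under (a, t) |-> a :: t. *)
Fixpoint lebesgue_Rn {R : realType} (d : nat) :
    {sigma_finite_measure set (Rn R d) -> \bar R} :=
  match d with
  | 0 => \d_([tuple] : Rn R 0)
  | d'.+1 => lebesgue_succ (lebesgue_Rn d')
  end.

Section euclidean.
Context {R : realType} {d : nat}.
Implicit Types x y : Rn R d.

Definition enorm x : R := Num.sqrt (\sum_(i < d) (tnth x i : R) ^+ 2).

Definition subRn x y : Rn R d := [tuple (tnth x i : R) - tnth y i | i < d].

Definition scaleRn (a : R) x : Rn R d := [tuple a * (tnth x i : R) | i < d].

End euclidean.

Section compound_poisson.
Context {R : realType} {d : nat}.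
Implicit Types f : Rn R d -> R.

Definition L1norm f : R := fine ('N[lebesgue_Rn d]_1 [EFin \o f]).

(* conv_pow f n is the n-fold convolution f^{n*}, for n >= 1 only (conv_pow f 0
   is f too).  The values are in \bar R because f^{n*} can be infinite at the
   origin when f is unbounded near 0. *)
Definition conv_pow f (n : nat) : Rn R d -> \bar R :=
  iter n.-1
    (fun h x => \int[lebesgue_Rn d]_y ((f (subRn x y))%:E * h y))%E
    (EFin \o f).

Definition cpoisson_density f (lambda : R) (x : Rn R d) : \bar R :=
  ((expR (- lambda * L1norm f))%:E *
   \sum_(1 <= n <oo) ((lambda ^+ n / n`!%:R)%:E * conv_pow f n x))%E.

End compound_poisson.

(* Main.v *)
Require Import Defs.
From HB Require Import structures.
From mathcomp Require Import all_boot all_order all_algebra.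
From mathcomp Require Import all_classical all_reals all_analysis.
From mathcomp Require Import measurable_realfun ring lra.

Set Implicit Arguments.
Unset Strict Implicit.
Unset Printing Implicit Defensive.

Import Order.TTheory GRing.Theory Num.Theory.
Import numFieldNormedType.Exports.

Local Open Scope classical_set_scope.
Local Open Scope ring_scope.

(** Write r = |x|, rho = (d + 1) / 2 - gamma, z = lambda r^rho, and let S be the
    series of the lambda^n f^{n*}(x) / n!, so that the density is
    exp (- lambda |f|_1) S.  The mass that f^{n*} puts near x comes from chains
    of n steps that follow the segment from 0 to x.  A step of length t >= 1 can
    stray sideways by about sqrt t at no exponential cost, so it behaves like a
    step of the one-dimensional kernel t^((d-1)/2 - gamma) exp (- m t), whose
    mass after removing exp (- (m - s) t) is of order s^(-rho).

    Upper bound.  Let L(s) be the mass of f tilted by exp ((m - s) y . theta),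
    where theta = x / r and 0 < s <= m.  The tilt is multiplicative under
    convolution ([conv_pow_tilt]).  A sum of n steps equal to x contains a step
    of length at least r / n, and the tilted f is at most the power -gamma of
    the length; hence the tilted n-th power at x is at most
    n (r / n)^(-gamma) L(s)^(n-1) ([conv_pow_le]).  Summing over n,
    S <= K lambda r^(-gamma) exp (- m r) exp (s r + C lambda L(s))
    ([poisson_series_upper]), and L(s) <= C s^(-rho) ([tilted_mass]).  With
    s = m / r this is the bound for z <= 1.  For z >= 1 and lambda at most a
    multiple of r, the choice s = c (lambda / r)^(1 / (rho + 1)) makes both s r
    and lambda s^(-rho) proportional to z^(1 / (rho + 1)).  If lambda exceeds
    that multiple of r, the bound without tilt suffices: M_2 > |f|_1 because
    C_1 >= exp m, and the surplus exp (lambda (M_2 - |f|_1)) pays for exp (m r)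
    and for the powers of r and lambda.

    Lower bound.  For z <= 1 the first term of S is enough.  In general, take
    tau = r / n.  Adding one step that lies in a tube around the direction of x,
    of length tau and width min (tau, sqrt tau), increases the total length of
    the chain by at most 1 over the distance covered.  By induction
    ([conv_pow_chain]) f^{n*}(x) >= exp (- m r) r^(-(d+1)/2) (kappa q(tau))^n,
    where q(tau) = tau^rho if tau >= 1 and tau^rho1 if tau <= 1
    ([conv_pow_lower]).  The single term n of order z^(1 / (rho1 + 1)) of S then
    gives the exponential ([poisson_series_lower]).

    The directions theta are arbitrary, and everything is computed without
    rotations: some coordinate i of theta has theta_i^2 >= 1 / d, and subtracting
    from y the multiple of theta with the same i-th coordinate is, for y_i fixed,
    a translation of the other coordinates.  Tubes around R theta and Gaussian
    type weights across it thus become products of one-dimensional integrals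
    ([integral_shear]). *)

(** * Integrals over the line *)

Section OneDim.
Context {R : realType}.
Local Notation mu := (@lebesgue_measure R).
Local Notation mR := (measurableTypeR R).

(** Lebesgue measure is determined by its values on bounded intervals. *)
Lemma lebesgue_measure_reflect (c : R) (A : set R) : measurable A ->
  pushforward mu (fun t : mR => (c - t : mR)) A = mu A.
Proof.
move=> mA.
have mf : measurable_fun setT (fun t : mR => (c - t : mR)).
  exact: measurable_funB.
pose mix := isMeasurableFun.Build _ _ mR mR (fun t : mR => c - t : mR) mf.
pose f : {mfun mR >-> mR} := HB.pack (fun t : mR => c - t : mR) mix.
apply/esym. have /= := @lebesgue_measure_unique R (pushforward mu f).
apply => // _ [[a b]] _ <-.
rewrite /pushforward (_ : _ @^-1` _ = `[c - b, c - a[%classic).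
  rewrite !lebesgue_measure_itv/= !lte_fin ltrD2l ltrN2; case: ifP => //.
  by rewrite -!EFinB => _; congr EFin; ring.
by apply/seteqP; split => x /=; rewrite !in_itv/=; lra.
Qed.

Lemma integral_reflect (c : R) (F : mR -> \bar R) : measurable_fun setT F ->
  (forall t, 0 <= F t)%E ->
  (\int[mu]_t F (c - t)%R = \int[mu]_t F t)%E.
Proof.
move=> mF F0.
have mf : measurable_fun setT (fun t : mR => (c - t : mR)).
  exact: measurable_funB.
rewrite -[LHS](ge0_integral_pushforward mf mu (D := setT) (f := F))//.
apply: eq_measure_integral => A mA _; exact: lebesgue_measure_reflect.
Qed.

Lemma integral_shift (c : R) (F : mR -> \bar R) : measurable_fun setT F ->
  (forall t, 0 <= F t)%E ->
  (\int[mu]_t F (t - c)%R = \int[mu]_t F t)%E.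
Proof.
move=> mF F0.
have mf : measurable_fun setT (fun t : mR => (- t : mR)).
  exact: measurable_funN.
rewrite -[RHS](integral_reflect 0)//.
rewrite -[LHS](integral_reflect c)//; last exact/measurableT_comp/measurable_funB.
by apply: eq_integral => t _; congr F; ring.
Qed.

Lemma integral_exp_abs (c : R) : 0 < c ->
  (\int[mu]_t (expR (- c * `|t|))%:E = (2 / c)%:E)%E.
Proof.
move=> c0.
rewrite ge0_symfun_integralT//; first last.
- by move=> x /=; rewrite normrN.
- move=> x; apply: continuous_comp; last exact: continuous_expR.
  apply: (@continuousM R R) => //; first exact: cst_continuous.
  exact: norm_continuous.
have := @integral_exponential_pdf R c c0.
rewrite /exponential_pdf.
under eq_integral do rewrite -[X in X%:E]/((_ \_ _) _).
rewrite -set_itvcy EFinM => h; congr (_ * _)%E.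
transitivity (\int[mu]_(x in `[0%R, +oo[) ((c^-1)%:E * (c * expR (- c * x))%:E))%E.
  apply: eq_integral => x; rewrite inE/= in_itv/= andbT => x0.
  by rewrite -EFinM mulrA mulVf ?gt_eqF// mul1r ger0_norm.
rewrite ge0_integralZl//; first last.
- by rewrite lee_fin invr_ge0 ltW.
- by move=> x _; rewrite lee_fin mulr_ge0 ?expR_ge0 ?ltW.
- apply/measurable_EFinP; apply: measurable_funM => //.
  apply: measurableT_comp => //; exact: measurable_funM.
rewrite integral_mkcond -[RHS]mule1 -h; congr (_ * _)%E.
by apply: eq_integral => x _; rewrite !patchE; case: ifP.
Qed.

Lemma measurable_indic_le {disp} {T : measurableType disp} (N : T -> R) h :
  measurable_fun setT N -> measurable_fun setT (fun y => (N y <= h)%R%:R : R).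
Proof.
move=> mN; have mI : measurable [set y | N y <= h].
  rewrite (_ : [set y | _] = setT `&` N @^-1` `]-oo, h]%classic).
    exact: mN.
  by apply/seteqP; split => y /=; rewrite in_itv/=; [split|case].
apply: eq_measurable_fun (measurable_indic (D := setT) mI) => t _.
by rewrite indicE; congr (_%:R); rewrite mem_setE.
Qed.

Lemma measurable_abs_le (h : R) :
  measurable_fun setT (fun t : mR => (`|t| <= h)%R%:R : R).
Proof. by apply: measurable_indic_le; exact: normr_measurable. Qed.

Lemma integral_indic_abs (h : R) : 0 <= h ->
  (\int[mu]_t ((`|t| <= h)%R%:R)%:E = (2 * h)%:E)%E.
Proof.
move=> h0.
transitivity (\int[mu]_t (\1_(`[- h, h]%classic) t)%:E)%E.
  apply: eq_integral => t _; rewrite indicE; congr ((_%:R)%:E).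
  by rewrite mem_setE in_itv/= ler_norml.
rewrite integral_indic// setIT -[LHS]/(mu `[(- h), h]%classic) lebesgue_measure_itv/= lte_fin.
case: ifP => H; first by rewrite -EFinB; congr EFin; ring.
by congr EFin; move: H; lra.
Qed.

End OneDim.

(** * Lebesgue measure on R^d *)

Section RnBasics.
Context {R : realType}.
Local Notation mu := (@lebesgue_measure R).
Local Notation mR := (measurableTypeR R).

Lemma integral_Rn0 (F : Rn R 0 -> \bar R) :
  (\int[lebesgue_Rn 0]_y F y = F [tuple])%E.
Proof.
have mF : measurable_fun setT F.
  apply: (@eq_measurable_fun _ _ _ _ setT (cst (F [tuple]))) => //.
  by move=> y _; rewrite (tuple0 y).
by rewrite /= integral_dirac// diracT mul1e.
Qed.

Lemma measurable_consT {n : nat} : measurable_fun setT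
  (fun p : mR * Rn R n => [tuple of p.1 :: p.2] : Rn R n.+1).
Proof. exact: measurable_cons. Qed.

(** Tonelli for the recursive definition of Lebesgue measure on R^d. *)
Lemma integral_RnS {n : nat} (F : Rn R n.+1 -> \bar R) :
  measurable_fun setT F -> (forall y, 0 <= F y)%E ->
  (\int[lebesgue_Rn n.+1]_y F y =
   \int[mu]_a \int[lebesgue_Rn n]_y F [tuple of a :: y])%E.
Proof.
move=> mF F0.
have mG : measurable_fun setT
    (F \o (fun p : mR * Rn R n => [tuple of p.1 :: p.2] : Rn R n.+1)).
  by apply: measurableT_comp => //; exact: measurable_consT.
transitivity (\int[mu \x lebesgue_Rn n]_p F [tuple of p.1 :: p.2])%E.
  exact: (ge0_integral_pushforward measurable_consT
    (mu \x lebesgue_Rn n)%E measurableT mF (fun y _ => F0 y)).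
exact: (fubini_tonelli1 _ mG (fun p => F0 _)).
Qed.

Lemma measurable_fun_Rn {d} {T : measurableType d} {n} (h : T -> Rn R n) :
  (forall i, measurable_fun setT (fun x => tnth (h x) i : mR)) ->
  measurable_fun setT h.
Proof. by move=> H; apply: (measurable_fun_tnthP h).2. Qed.

Lemma measurable_fun_tnth {d} {T : measurableType d} {n} (h : T -> Rn R n) i :
  measurable_fun setT h -> measurable_fun setT (fun x => tnth (h x) i : mR).
Proof. by move=> mh; exact: (measurable_fun_tnthP h).1. Qed.

Lemma measurable_subRn {d} {T : measurableType d} {n} (h k : T -> Rn R n) :
  measurable_fun setT h -> measurable_fun setT k ->
  measurable_fun setT (fun x => subRn (h x) (k x)).
Proof.
move=> mh mk; apply: measurable_fun_Rn => i.
apply: (@eq_measurable_fun _ _ _ _ _ (fun x => tnth (h x) i - tnth (k x) i)).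
  by move=> x _; rewrite tnth_mktuple.
by apply: measurable_funB; exact: measurable_fun_tnth.
Qed.

Lemma measurable_enorm {n} : measurable_fun setT (@enorm R n).
Proof.
apply: (@measurableT_comp _ _ _ _ _ _ (@Num.sqrt R)).
  exact: (continuous_measurable_fun (@sqrt_continuous R)).
apply: measurable_sum => i; apply: measurable_funX; exact: measurable_tnth.
Qed.

(** Reflection and translation at once, which is the change of variable that
    turns y into the increment x - y in a convolution. *)
Lemma integral_subRn {n} (x : Rn R n) (F : Rn R n -> \bar R) :
  measurable_fun setT F -> (forall y, 0 <= F y)%E ->
  (\int[lebesgue_Rn n]_y F (subRn x y) = \int[lebesgue_Rn n]_y F y)%E.
Proof.
elim: n x F => [|n IH] x F mF F0.
  by rewrite !integral_Rn0; congr F; apply/eq_from_tnth => -[].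
rewrite !integral_RnS//; last first.
  by apply: measurableT_comp => //; exact: measurable_subRn.
have mcons a : measurable_fun setT (fun y : Rn R n => [tuple of a :: y] : Rn R n.+1).
  exact: measurable_cons.
transitivity (\int[mu]_a (\int[lebesgue_Rn n]_y F [tuple of (thead x - a)%R :: y]))%E.
  apply: eq_integral => a _.
  rewrite -[RHS](IH [tuple of behead x])//; last first.
    by apply: measurableT_comp => //; exact: mcons.
  apply: eq_integral => y _; congr F; apply/eq_from_tnth => i.
  rewrite tnth_mktuple; case: (unliftP ord0 i) => [j|] -> /=.
    by rewrite !tnthS tnth_mktuple; congr (_ - _); rewrite {1}(tuple_eta x) tnthS.
  by rewrite !tnth0.
rewrite (@integral_reflect _ _ (fun a => \int[lebesgue_Rn n]_y F [tuple of a :: y]))%E//.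
  apply: (@measurable_fun_fubini_tonelli_F _ _ _ _ _ (lebesgue_Rn n)
    (fun p : mR * Rn R n => F [tuple of p.1 :: p.2])) => //.
  by apply: measurableT_comp => //; exact: measurable_consT.
by move=> t; exact: integral_ge0.
Qed.

End RnBasics.

(** * Sheared product integrals *)

Section Shear.
Context {R : realType}.
Local Notation mu := (@lebesgue_measure R).
Local Notation mR := (measurableTypeR R).

Lemma prod_neq_ord0 n (F : 'I_n.+1 -> R) :
  \prod_(j | j != ord0) F j = \prod_(j < n) F (lift ord0 j).
Proof. by rewrite big_mkcond big_ord_recl eqxx /= mul1r. Qed.

Lemma prod_neq_lift n (i : 'I_n) (F : 'I_n.+1 -> R) :
  \prod_(j | j != lift ord0 i) F j =
  F ord0 * \prod_(j < n | j != i) F (lift ord0 j).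
Proof.
rewrite big_mkcond big_ord_recl /=; congr (_ * _).
rewrite [RHS]big_mkcond; apply: eq_bigr => j _.
by rewrite (inj_eq (@lift_inj _ ord0)).
Qed.

Lemma measurable_prodr {d} {T : measurableType d} (I : Type) (s : seq I)
    (P : pred I) (h : I -> T -> R) :
  (forall i, measurable_fun setT (h i)) ->
  measurable_fun setT (fun x => \prod_(i <- s | P i) h i x).
Proof.
move=> mh; elim: s => [|i s IH].
  by apply: eq_measurable_fun (measurable_cst (1 : R)) => x _; rewrite big_nil.
case Pi: (P i).
  apply: eq_measurable_fun (measurable_funM (mh i) IH) => x _.
  by rewrite big_cons Pi.
by apply: eq_measurable_fun IH => x _; rewrite big_cons Pi.
Qed.

Lemma integral_prod_shift n (G : R -> R) (w : R) (c : 'I_n -> R) :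
  measurable_fun setT G -> (forall t, 0 <= G t) ->
  (\int[mu]_t (G t)%:E = w%:E)%E ->
  (\int[lebesgue_Rn n]_y (\prod_(j < n) G (tnth y j - c j))%:E = (w ^+ n)%:E)%E.
Proof.
move=> mG G0 Gw; elim: n c => [|n IH] c.
  by rewrite integral_Rn0 big_ord0 expr0.
have mshift (r : R) : measurable_fun setT (fun t : mR => G (t - r)).
  by apply: measurableT_comp => //; exact: measurable_funB.
rewrite integral_RnS; last 2 first.
- apply/measurable_EFinP; apply: measurable_prodr => j.
  apply: (measurableT_comp (mshift _)); exact: measurable_tnth.
- by move=> y; rewrite lee_fin prodr_ge0.
transitivity (\int[mu]_t ((w ^+ n)%:E * (G (t - c ord0))%:E))%E.
  apply: eq_integral => t _; rewrite -(IH (fun j => c (lift ord0 j))) muleC.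
  rewrite -ge0_integralZl//; last 3 first.
  - apply/measurable_EFinP; apply: measurable_prodr => j.
    apply: (measurableT_comp (mshift _)); exact: measurable_tnth.
  - by move=> y _; rewrite lee_fin prodr_ge0.
  - by rewrite lee_fin.
  apply: eq_integral => y _; rewrite big_ord_recl -EFinM tnth0; congr (_ * _)%:E.
  by apply: eq_bigr => j _; rewrite tnthS.
have w0 : 0 <= w.
  by rewrite -lee_fin -Gw; apply: integral_ge0 => t _; rewrite lee_fin.
rewrite ge0_integralZl//; last 3 first.
- exact/measurable_EFinP.
- by move=> t _; rewrite lee_fin.
- by rewrite lee_fin exprn_ge0.
rewrite (@integral_shift _ _ (fun t => (G t)%:E)) ?Gw -?EFinM ?exprSr//.
exact/measurable_EFinP.
Qed.

Lemma measurable_shear n (i : 'I_n) (phi : R -> R) (psi : R -> R -> R)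
    (q : 'I_n -> R) :
  measurable_fun setT phi ->
  measurable_fun setT (fun p : mR * mR => psi p.1 p.2) ->
  measurable_fun setT (fun y : Rn R n => phi (tnth y i) *
    \prod_(j | j != i) psi (tnth y i) (tnth y j - q j * tnth y i)).
Proof.
move=> mphi mpsi; apply: measurable_funM.
  by apply: measurableT_comp => //; exact: measurable_tnth.
apply: measurable_prodr => j.
apply: (@measurableT_comp _ _ _ _ _ _ _ _
  (fun y : Rn R n => (tnth y i : mR, tnth y j - q j * tnth y i : mR)) mpsi).
apply/measurable_fun_pairP; split; first exact: measurable_tnth.
apply: measurable_funB; first exact: measurable_tnth.
by apply: measurable_funM => //; exact: measurable_tnth.
Qed.

(** For fixed y_i = a each remaining factor is a translate of psi a and
    contributes W a.  The induction on the dimension lets phi absorb the factor of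
    the first coordinate when that is not the coordinate i. *)
Lemma integral_shear n (i : 'I_n.+1) (phi : R -> R) (psi : R -> R -> R)
    (q : 'I_n.+1 -> R) (W : R -> R) :
  measurable_fun setT phi -> (forall a, 0 <= phi a) ->
  measurable_fun setT (fun p : mR * mR => psi p.1 p.2) ->
  (forall a t, 0 <= psi a t) ->
  (forall a, \int[mu]_t (psi a t)%:E = (W a)%:E)%E ->
  (\int[lebesgue_Rn n.+1]_y (phi (tnth y i) *
     \prod_(j | j != i) psi (tnth y i) (tnth y j - q j * tnth y i))%:E =
   \int[mu]_a (phi a * W a ^+ n)%:E)%E.
Proof.
move=> + + mpsi psi0 psiW.
have W0 a : 0 <= W a.
  by rewrite -lee_fin -psiW; apply: integral_ge0 => t _; rewrite lee_fin.
have mW : measurable_fun setT W.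
  apply/measurable_EFinP; apply: (@eq_measurable_fun _ _ _ _ _
    (fubini_F mu (fun p : mR * mR => (psi p.1 p.2)%:E))).
    by move=> a _; rewrite /fubini_F psiW.
  apply: measurable_fun_fubini_tonelli_F; first exact/measurable_EFinP.
  by move=> p; rewrite lee_fin.
have mpsi2 d (T : measurableType d) (u v : T -> mR) :
    measurable_fun setT u -> measurable_fun setT v ->
    measurable_fun setT (fun x => psi (u x) (v x)).
  move=> mu' mv.
  apply: (@measurableT_comp _ _ _ _ _ _ _ _ (fun x => (u x, v x)) mpsi).
  exact/measurable_fun_pairP.
have mint n' (i' : 'I_n'.+1) (phi' : R -> R) (q' : 'I_n'.+1 -> R) :
    measurable_fun setT phi' ->
    measurable_fun setT (fun y : Rn R n'.+1 => (phi' (tnth y i') *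
     \prod_(j | j != i') psi (tnth y i') (tnth y j - q' j * tnth y i'))%:E).
  by move=> mphi'; apply/measurable_EFinP; exact: measurable_shear.
elim: n i phi q => [|n IH] i phi q mphi phi0;
  (rewrite integral_RnS; [|exact: mint|
    by move=> y; rewrite lee_fin mulr_ge0// prodr_ge0]);
  case: (unliftP ord0 i) => [i'|] ->.
- by case: i'.
- apply: eq_integral => a _; rewrite integral_Rn0 prod_neq_ord0 big_ord0.
  by rewrite expr0 !mulr1 tnth0.
- transitivity (\int[mu]_t \int[mu]_a
      (phi a * psi a (t - q ord0 * a) * W a ^+ n)%:E)%E.
    apply: eq_integral => t _.
    rewrite -(IH i' (fun a => phi a * psi a (t - q ord0 * a))
      (fun j => q (lift ord0 j))); last 2 first.
    + apply: measurable_funM => //; apply: mpsi2 => //.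
      by apply: measurable_funB => //; exact: measurable_funM.
    + by move=> a; rewrite mulr_ge0.
    apply: eq_integral => y _; rewrite prod_neq_lift mulrA tnth0 tnthS.
    by congr (_ * _)%:E; apply: eq_bigr => j _; rewrite tnthS.
  rewrite (@fubini_tonelli _ _ _ _ _ mu mu
    (fun p : mR * mR => (phi p.2 * psi p.2 (p.1 - q ord0 * p.2) * W p.2 ^+ n)%:E)).
  + apply: eq_integral => a _ /=.
    transitivity (\int[mu]_t ((phi a * W a ^+ n)%:E *
        (psi a (t - q ord0 * a))%:E))%E.
      by apply: eq_integral => t _; rewrite -EFinM; congr EFin; ring.
    have mpsia : measurable_fun setT (fun t => psi a t) by exact: mpsi2.
    rewrite ge0_integralZl//; last 3 first.
    * apply/measurable_EFinP; apply: measurableT_comp => //.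
      exact: measurable_funB.
    * by move=> t _; rewrite lee_fin.
    * by rewrite lee_fin mulr_ge0// exprn_ge0.
    rewrite (@integral_shift _ _ (fun t => (psi a t)%:E)).
    * by rewrite psiW -EFinM exprSr mulrA.
    * exact/measurable_EFinP.
    * by move=> t; rewrite lee_fin.
  + apply/measurable_EFinP; apply: measurable_funM; first apply: measurable_funM.
    * exact: measurableT_comp.
    * apply: mpsi2 => //; apply: measurable_funB => //.
      exact: measurable_funM.
    * by apply: measurable_funX; exact: measurableT_comp.
  + by move=> p; rewrite lee_fin !mulr_ge0// exprn_ge0.
- apply: eq_integral => a _ /=.
  transitivity (\int[lebesgue_Rn n.+1]_y ((phi a)%:E *
     (\prod_(j < n.+1) psi a (tnth y j - q (lift ord0 j) * a))%:E))%E.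
    apply: eq_integral => y _; rewrite -EFinM prod_neq_ord0 tnth0.
    by congr (_ * _)%:E; apply: eq_bigr => j _; rewrite tnthS.
  have mpsia : measurable_fun setT (fun t => psi a t) by exact: mpsi2.
  rewrite ge0_integralZl//; last 3 first.
  + apply/measurable_EFinP; apply: measurable_prodr => j.
    apply: measurableT_comp => //.
    by apply: measurable_funB => //; exact: measurable_tnth.
  + by move=> y _; rewrite lee_fin prodr_ge0.
  + by rewrite lee_fin.
  by rewrite (@integral_prod_shift n.+1 (psi a) (W a) (fun j => q (lift ord0 j) * a)).
Qed.

End Shear.

(** * Oblique coordinates along a direction *)

Section Geometry.
Context {R : realType} {d : nat}.
Implicit Types x y u v theta : Rn R d.

Definition dot x y : R := \sum_(i < d) (tnth x i : R) * tnth y i.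

Lemma enorm_ge0 x : 0 <= enorm x. Proof. exact: sqrtr_ge0. Qed.

Lemma enorm_sqr x : enorm x ^+ 2 = dot x x.
Proof.
rewrite sqr_sqrtr; last by apply: sumr_ge0 => i _; exact: sqr_ge0.
by apply: eq_bigr => i _; rewrite expr2.
Qed.

(** Lagrange: twice the difference of the two sides is the sum of the squares
    of the a_i b_j - a_j b_i. *)
Lemma sum_mul_sqr_le (P : pred 'I_d) (a b : 'I_d -> R) :
  (\sum_(i | P i) a i * b i) ^+ 2 <=
  (\sum_(i | P i) a i ^+ 2) * (\sum_(i | P i) b i ^+ 2).
Proof.
suff : 0 <= \sum_(i | P i) \sum_(j | P j) (a i * b j - a j * b i) ^+ 2.
  under eq_bigr do under eq_bigr do rewrite sqrrB.
  under eq_bigr do rewrite big_split sumrB /=.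
  rewrite big_split sumrB /=.
  have -> : \sum_(i | P i) \sum_(j | P j) (a i * b j) ^+ 2 =
      (\sum_(i | P i) a i ^+ 2) * (\sum_(i | P i) b i ^+ 2).
    by rewrite big_distrlr /=; apply: eq_bigr => i _; apply: eq_bigr => j _; rewrite exprMn.
  have -> : \sum_(i | P i) \sum_(j | P j) (a j * b i) ^+ 2 =
      (\sum_(i | P i) a i ^+ 2) * (\sum_(i | P i) b i ^+ 2).
    by rewrite mulrC big_distrlr /=; apply: eq_bigr => i _; apply: eq_bigr => j _;
      rewrite exprMn mulrC.
  have -> : \sum_(i | P i) \sum_(j | P j) a i * b j * (a j * b i) *+ 2 =
      (\sum_(i | P i) a i * b i) ^+ 2 *+ 2.
    rewrite expr2 big_distrlr /= -sumrMnl; apply: eq_bigr => i _.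
    by rewrite -sumrMnl; apply: eq_bigr => j _; congr (_ *+ 2); ring.
  lra.
by apply: sumr_ge0 => i _; apply: sumr_ge0 => j _; exact: sqr_ge0.
Qed.

Lemma dot_le x y : dot x y <= enorm x * enorm y.
Proof.
apply: le_trans (ler_norm _) _; rewrite -[leRHS]ger0_norm ?mulr_ge0 ?enorm_ge0//.
rewrite -ler_sqr ?nnegrE// !real_normK ?num_real// exprMn !enorm_sqr.
apply: le_trans (sum_mul_sqr_le _ _ _) _.
by rewrite /dot; under eq_bigr do rewrite expr2; under [X in _ * X]eq_bigr do rewrite expr2.
Qed.

Lemma abs_tnth_le x i : `|tnth x i : R| <= enorm x.
Proof.
rewrite -ler_sqr ?nnegrE ?enorm_ge0// real_normK ?num_real// enorm_sqr /dot.
rewrite (bigD1 i)//= -expr2 lerDl; apply: sumr_ge0 => j _.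
by rewrite -expr2 sqr_ge0.
Qed.

(** The d squared coordinates have sum 1, so they cannot all be less than 1 / d. *)
Lemma unit_coord theta : (0 < d)%N -> enorm theta = 1 ->
  exists i, 1 <= d%:R * (tnth theta i : R) ^+ 2.
Proof.
move=> d0 t1; apply: contrapT => /forallNP H.
have : d%:R * \sum_(i < d) (tnth theta i : R) ^+ 2 < \sum_(i < d) (1 : R).
  rewrite mulr_sumr; apply: ltr_sum => //; last by move=> i _; rewrite ltNge; exact/negP.
  by apply/hasP; exists (Ordinal d0); rewrite ?mem_index_enum.
rewrite (_ : \sum_(i < d) _ ^+ 2 = 1); last first.
  rewrite -[RHS](expr1n _ 2) -t1 enorm_sqr.
  by apply: eq_bigr => i _; rewrite expr2.
by rewrite mulr1 sumr_const card_ord ltxx.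
Qed.

Section Decomposition.
Variables (theta : Rn R d) (i : 'I_d).
Hypothesis theta1 : enorm theta = 1.
Hypothesis thetai : 1 <= d%:R * (tnth theta i : R) ^+ 2.

(** The point [slant y] * theta of the axis R theta is the projection of y parallel
    to the hyperplane where the i-th coordinate vanishes, and [offaxis y] is the
    remainder.  This oblique projection replaces the orthogonal one because
    for y_i fixed it only translates the other coordinates of y. *)
Definition slant y : R := tnth y i / tnth theta i.
Definition offaxis y (j : 'I_d) : R :=
  tnth y j - (tnth theta j / tnth theta i) * tnth y i.
Definition offnorm y : R := Num.sqrt (\sum_(j | j != i) offaxis y j ^+ 2).

Let ti0 : tnth theta i != 0 :> R.
Proof. by apply: contraTneq thetai => ->; rewrite expr0n mulr0 -ltNge. Qed.

Let offaxis_i y : offaxis y i = 0.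
Proof. by rewrite /offaxis divff// mul1r subrr. Qed.

Let tnthE y j : tnth y j = slant y * tnth theta j + offaxis y j :> R.
Proof. by rewrite /offaxis /slant; field. Qed.

Lemma offnorm_sqr y : offnorm y ^+ 2 = \sum_(j | j != i) offaxis y j ^+ 2.
Proof. by rewrite sqr_sqrtr// sumr_ge0// => j _; exact: sqr_ge0. Qed.

Lemma offnorm_ge0 y : 0 <= offnorm y. Proof. exact: sqrtr_ge0. Qed.

Let cross y := \sum_(j | j != i) offaxis y j * tnth theta j.

Let theta_dot : dot theta theta = 1.
Proof. by rewrite -enorm_sqr theta1 expr1n. Qed.

Let sum_theta : \sum_(j | j != i) (tnth theta j : R) ^+ 2 = 1 - tnth theta i ^+ 2.
Proof.
rewrite -theta_dot /dot [X in _ = X - _](bigD1 i)//= expr2 addrAC subrr add0r.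
by apply: eq_bigr => j _; rewrite expr2.
Qed.

Let dotE y : dot y theta = slant y + cross y.
Proof.
rewrite /dot; under eq_bigr do rewrite tnthE mulrDl -mulrA.
rewrite big_split /= -mulr_sumr -/(dot theta theta) theta_dot mulr1; congr (_ + _).
by rewrite (bigD1 i)//= offaxis_i mul0r add0r.
Qed.

Let normE y : enorm y ^+ 2 = slant y ^+ 2 + slant y * cross y *+ 2 + offnorm y ^+ 2.
Proof.
rewrite enorm_sqr /dot; under eq_bigr do rewrite tnthE -expr2 sqrrD exprMn.
rewrite big_split /= big_split /= -mulr_sumr.
have -> : \sum_(k < d) (tnth theta k : R) ^+ 2 = 1.
  by rewrite -theta_dot; apply: eq_bigr => k _; rewrite expr2.
rewrite mulr1; congr (_ + _ + _).
  rewrite (bigD1 i)//= offaxis_i mulr0 mul0rn add0r /cross mulr_sumr -sumrMnl.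
  by apply: eq_bigr => j _; congr (_ *+ 2); ring.
by rewrite offnorm_sqr (bigD1 i)//= offaxis_i expr0n add0r.
Qed.

Let cross_sqr y : cross y ^+ 2 <= offnorm y ^+ 2 * (1 - tnth theta i ^+ 2).
Proof. by rewrite offnorm_sqr -sum_theta; exact: sum_mul_sqr_le. Qed.

Let norm_cross y : `|cross y| <= offnorm y.
Proof.
rewrite -ler_sqr ?nnegrE ?offnorm_ge0// real_normK ?num_real//.
apply: le_trans (cross_sqr y) _.
by rewrite mulrBr mulr1 gerBl mulr_ge0 ?sqr_ge0.
Qed.

Let d_gt0 : 0 < d%:R :> R. Proof. by rewrite ltr0n; case: (i) => j; case: (d). Qed.

(** Off the axis, Cauchy-Schwarz only sees the coordinates of theta other than
    theta_i, whose squares have sum 1 - theta_i^2; this leaves at least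
    theta_i^2 >= 1 / d of the squared oblique distance. *)
Lemma transversal_ge y :
  offnorm y ^+ 2 <= d%:R * (enorm y ^+ 2 - dot y theta ^+ 2).
Proof.
rewrite normE dotE; have := cross_sqr y.
have : 0 <= offnorm y ^+ 2 by exact: sqr_ge0.
move: thetai; move: (tnth theta i ^+ 2) (offnorm y ^+ 2) (cross y) (slant y) d_gt0.
move: (d%:R : R) => D th N c s D0 H1 N0 H2.
have : D * c ^+ 2 <= D * (N * (1 - th)) by rewrite ler_pM2l.
have : N * 1 <= N * (D * th) by rewrite ler_wpM2l.
lra.
Qed.

Lemma transversal_le y : enorm y ^+ 2 - dot y theta ^+ 2 <= offnorm y ^+ 2.
Proof.
rewrite normE dotE; have := sqr_ge0 (cross y).
by move: (offnorm y ^+ 2) (cross y) (slant y) => N c s; lra.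
Qed.

Lemma dot_slant y : `|dot y theta - slant y| <= offnorm y.
Proof. by rewrite dotE addrC addKr. Qed.

Lemma enorm_le_slant y : enorm y <= `|slant y| + offnorm y.
Proof.
rewrite -ler_sqr ?nnegrE ?enorm_ge0 ?addr_ge0 ?offnorm_ge0//.
rewrite normE sqrrD real_normK ?num_real// lerD2r lerD2l lerMn2r /=.
by rewrite (le_trans (ler_norm _))// normrM ler_wpM2l.
Qed.

Lemma theta_inv_le : `|(tnth theta i)^-1 : R| <= d%:R.
Proof.
have D1 : 1 <= d%:R :> R by rewrite ler1n; case: (i) => j; case: (d).
rewrite -ler_sqr ?nnegrE// real_normK ?num_real// exprVn.
have tp : 0 < tnth theta i ^+ 2 :> R by rewrite exprn_even_gt0.
rewrite -div1r ler_pdivrMr//; apply: le_trans thetai _.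
by apply: ler_wpM2r; rewrite ?(ltW tp)// expr2 ler_peMl.
Qed.

Lemma abs_offaxis_le y j : j != i -> `|offaxis y j| <= offnorm y.
Proof.
move=> ji; rewrite -ler_sqr ?nnegrE ?offnorm_ge0// real_normK ?num_real//.
by rewrite offnorm_sqr (bigD1 j)//= lerDl sumr_ge0// => k _; exact: sqr_ge0.
Qed.

Lemma sum_offaxis_le y : \sum_(j | j != i) `|offaxis y j| <= d%:R * offnorm y.
Proof.
apply: (@le_trans _ _ (\sum_(j | j != i) offnorm y)).
  by apply: ler_sum => j; exact: abs_offaxis_le.
rewrite sumr_const -[leLHS]mulr_natl ler_wpM2r ?offnorm_ge0// ler_nat.
by rewrite -[leqRHS]card_ord max_card.
Qed.

Lemma offnorm_le y h : 0 <= h -> (forall j, j != i -> `|offaxis y j| <= h) ->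
  offnorm y <= d%:R * h.
Proof.
move=> h0 H; rewrite -ler_sqr ?nnegrE ?offnorm_ge0 ?mulr_ge0// offnorm_sqr.
have D1 : 1 <= d%:R :> R by rewrite ler1n; case: (i) => j; case: (d).
apply: (@le_trans _ _ (\sum_(j | j != i) h ^+ 2)).
  apply: ler_sum => j ji.
  by rewrite -(real_normK (num_real _)) ler_sqr ?nnegrE//; exact: H.
rewrite sumr_const -[leLHS]mulr_natl exprMn ler_wpM2r ?sqr_ge0//.
apply: (@le_trans _ _ d%:R); first by rewrite ler_nat -[leqRHS]card_ord max_card.
by rewrite expr2 ler_peMl.
Qed.

End Decomposition.
End Geometry.

(** * Convolution powers *)

Section Convolution.
Context {R : realType} {d : nat}.
Local Notation leb := (@lebesgue_Rn R d).
Implicit Types x y u theta : Rn R d.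

Lemma dot_subl x y theta : dot (subRn x y) theta = dot x theta - dot y theta.
Proof.
rewrite /dot -sumrB; apply: eq_bigr => i _.
by rewrite tnth_mktuple mulrBl.
Qed.

Lemma dotC x y : dot x y = dot y x.
Proof. by apply: eq_bigr => i _; rewrite mulrC. Qed.

Lemma enorm_sub_le x y : enorm x <= enorm (subRn x y) + enorm y.
Proof.
rewrite -ler_sqr ?nnegrE ?addr_ge0 ?enorm_ge0// sqrrD !enorm_sqr.
have := dot_le (subRn x y) y.
rewrite !(dot_subl, dotC _ (subRn _ _)) (dotC y x); lra.
Qed.

Lemma measurable_dot theta : measurable_fun setT (dot ^~ theta).
Proof.
by apply: measurable_sum => i; apply: measurable_funM => //; exact: measurable_tnth.
Qed.

Lemma integral_subRn_l y (F : Rn R d -> \bar R) :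
  measurable_fun setT F -> (forall u, 0 <= F u)%E ->
  (\int[leb]_x F (subRn x y) = \int[leb]_x F x)%E.
Proof.
move=> mF F0; pose o : Rn R d := [tuple 0 | i < d].
rewrite -[LHS](integral_subRn o)//; last first.
  by apply: measurableT_comp => //; exact: measurable_subRn.
rewrite -[RHS](integral_subRn (subRn o y))//.
apply: eq_integral => x _; congr F; apply/eq_from_tnth => i.
by rewrite !tnth_mktuple; ring.
Qed.

Variable f : Rn R d -> R.
Hypotheses (mf : measurable_fun setT f) (f0 : forall x, 0 <= f x).

Lemma conv_powS n x : conv_pow f n.+2 x =
  (\int[leb]_y ((f (subRn x y))%:E * conv_pow f n.+1 y))%E.
Proof. by []. Qed.

Lemma conv_pow_ge0 n x : (0 <= conv_pow f n.+1 x)%E.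
Proof.
elim: n x => [|n IH] x; first by rewrite lee_fin.
by rewrite conv_powS; apply: integral_ge0 => y _; rewrite mule_ge0// lee_fin.
Qed.

Let mkernel (h : Rn R d -> \bar R) : measurable_fun setT h ->
  measurable_fun setT (fun p : Rn R d * Rn R d =>
    (f (subRn p.1 p.2))%:E * h p.2)%E.
Proof.
move=> mh; apply: emeasurable_funM; last exact: measurableT_comp.
apply/measurable_EFinP; apply: measurableT_comp => //.
exact: measurable_subRn.
Qed.

Lemma measurable_conv_pow n : measurable_fun setT (conv_pow f n.+1).
Proof.
elim: n => [|n IH]; first exact/measurable_EFinP.
apply: (measurable_fun_fubini_tonelli_F _ (mkernel IH)) => p.
by rewrite mule_ge0 ?lee_fin// conv_pow_ge0.
Qed.

Let mfsub x : measurable_fun setT (fun y => (f (subRn x y))%:E).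
Proof. by apply/measurable_EFinP; apply: measurableT_comp => //; exact: measurable_subRn. Qed.

Variable L : R.
Hypothesis fL : (\int[leb]_x (f x)%:E = L%:E)%E.

Let L0 : 0 <= L.
Proof. by rewrite -lee_fin -fL; apply: integral_ge0 => x _; rewrite lee_fin. Qed.

Let fE : measurable_fun setT (fun x => (f x)%:E). Proof. exact/measurable_EFinP. Qed.
Let fE0 x : (0 <= (f x)%:E)%E. Proof. by rewrite lee_fin. Qed.

Lemma integral_conv_pow n :
  (\int[leb]_x conv_pow f n.+1 x = (L ^+ n.+1)%:E)%E.
Proof.
elim: n => [|n IH]; first by rewrite expr1.
rewrite (@fubini_tonelli _ _ _ _ _ leb leb (fun p => (f (subRn p.1 p.2))%:E * conv_pow f n.+1 p.2)%E).
- transitivity (\int[leb]_y (L%:E * conv_pow f n.+1 y))%E.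
    apply: eq_integral => y _ /=.
    under eq_integral do rewrite muleC.
    rewrite ge0_integralZl//.
    + by rewrite (integral_subRn_l y fE fE0) fL muleC.
    + by apply/measurable_EFinP; apply: measurableT_comp => //; exact: measurable_subRn.
    + exact: (conv_pow_ge0 n y).
  rewrite ge0_integralZl//.
  + by rewrite IH -EFinM -exprS.
  + exact: measurable_conv_pow.
  + by move=> x _; exact: conv_pow_ge0.
- exact: (mkernel (measurable_conv_pow n)).
- by move=> p; rewrite mule_ge0 ?lee_fin// conv_pow_ge0.
Qed.

(** If x is a sum of n + 1 increments, one of them has length at least
    |x| / (n + 1); the others are integrated out.  In the induction the splitting
    |x| = |x| / (n + 2) + |x| (n + 1) / (n + 2) keeps the argument of B equal to
    s / (n + 2) on both sides. *)
Lemma conv_pow_le (B : R -> R) : (forall s, 0 < s -> 0 <= B s) ->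
  (forall s u, 0 < s -> s <= enorm u -> f u <= B s) ->
  forall n s x, 0 < s -> s <= enorm x ->
  (conv_pow f n.+1 x <= (n.+1%:R * B (s / n.+1%:R) * L ^+ n)%:E)%E.
Proof.
move=> B0 fB; elim=> [|n IH] s x s0 sx.
  by rewrite divr1 mul1r expr0 mulr1 lee_fin fB.
rewrite conv_powS.
set s1 := s / n.+2%:R; set s2 := s * n.+1%:R / n.+2%:R.
have s10 : 0 < s1 by rewrite divr_gt0.
have s20 : 0 < s2 by rewrite divr_gt0// mulr_gt0.
have s12 : s1 + s2 = s.
  by rewrite /s1 /s2 -mulrDl -{1}(mulr1 s) -mulrDr nat1r mulfK.
have s2n : s2 / n.+1%:R = s1.
  by rewrite /s2 /s1 mulrAC mulfK.
set b := n.+1%:R * B s1 * L ^+ n.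
have b0 : 0 <= b by rewrite /b !mulr_ge0 ?exprn_ge0 ?B0.
apply: (@le_trans _ _ (\int[leb]_y ((B s1)%:E * conv_pow f n.+1 y + b%:E * (f (subRn x y))%:E))%E).
  apply: ge0_le_integral => //.
  - by move=> y _; rewrite mule_ge0 ?lee_fin// conv_pow_ge0.
  - by apply: emeasurable_funM => //; exact: measurable_conv_pow.
  - apply: emeasurable_funD; apply: emeasurable_funM => //.
    exact: measurable_conv_pow.
  - move=> y _; have [h|h] := leP s1 (enorm (subRn x y)).
      rewrite -[leLHS]adde0; apply: leeD; last by rewrite mule_ge0 ?lee_fin.
      by apply: lee_wpmul2r; [exact: conv_pow_ge0|rewrite lee_fin fB].
    rewrite -[leLHS]add0e; apply: leeD.
      by rewrite mule_ge0 ?lee_fin ?B0// conv_pow_ge0.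
    rewrite muleC; apply: lee_wpmul2r; first by rewrite lee_fin.
    rewrite /b -s2n; apply: IH => //.
    by have := enorm_sub_le x y; move: sx h; rewrite -s12; lra.
rewrite ge0_integralD//; last 4 first.
- by move=> y _; rewrite mule_ge0 ?lee_fin ?B0// conv_pow_ge0.
- by apply: emeasurable_funM => //; exact: measurable_conv_pow.
- by move=> y _; rewrite mule_ge0 ?lee_fin.
- exact: emeasurable_funM.
rewrite ge0_integralZl//; last 3 first.
- exact: measurable_conv_pow.
- by move=> y _; exact: conv_pow_ge0.
- by rewrite lee_fin B0.
rewrite (@ge0_integralZl _ _ _ leb _ measurableT _ (mfsub x) b%:E)//.
rewrite (integral_subRn x fE fE0) integral_conv_pow fL -!EFinM -EFinD lee_fin.
by rewrite /b exprS -(nat1r n.+1) le_eqVlt; apply/orP; left; apply/eqP; ring.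
Qed.

End Convolution.

Section Tilt.
Context {R : realType} {d : nat}.
Local Notation leb := (@lebesgue_Rn R d).

(** The exponent of the tilt is additive in the increments. *)
Lemma conv_pow_tilt (f : Rn R d -> R) (k : R) (theta : Rn R d) n x :
  measurable_fun setT f -> (forall x, 0 <= f x) ->
  (conv_pow (fun y => f y * expR (k * dot y theta))%R n.+1 x =
   (expR (k * dot x theta))%:E * conv_pow f n.+1 x)%E.
Proof.
move=> mf f0; elim: n x => [|n IH] x; first by rewrite /= -EFinM mulrC.
rewrite !conv_powS -ge0_integralZl//.
- apply: eq_integral => y _; rewrite IH muleA muleA -!EFinM; congr (_%:E * _)%E.
  rewrite -mulrA -expRD mulrC; congr (expR _ * _).
  by rewrite dot_subl; ring.
- apply: emeasurable_funM; last exact: measurable_conv_pow.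
  by apply/measurable_EFinP; apply: measurableT_comp => //; exact: measurable_subRn.
- by move=> y _; rewrite mule_ge0 ?lee_fin ?f0// conv_pow_ge0.
Qed.
End Tilt.

(** * Lower bound for convolution powers by chaining *)

Section Direction.
Context {R : realType} {d : nat}.
Implicit Types x y u theta : Rn R d.

Lemma direction x : 0 < enorm x ->
  exists2 theta, enorm theta = 1 & forall j, tnth x j = enorm x * tnth theta j :> R.
Proof.
move=> x0; exists (scaleRn (enorm x)^-1 x).
  rewrite -(ger0_norm (enorm_ge0 _)); apply/eqP; rewrite -sqrp_eq1//.
  rewrite real_normK ?num_real// enorm_sqr /dot.
  under eq_bigr do rewrite tnth_mktuple mulrACA.
  rewrite -mulr_sumr -/(dot x x) -enorm_sqr; apply/eqP; field; exact/lt0r_neq0.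
by move=> j; rewrite tnth_mktuple mulrA mulfV ?mul1r// gt_eqF.
Qed.

Lemma dot_direction x theta : enorm theta = 1 ->
  (forall j, tnth x j = enorm x * tnth theta j :> R) -> dot x theta = enorm x.
Proof.
move=> t1 xt; rewrite /dot; under eq_bigr do rewrite xt -mulrA.
by rewrite -mulr_sumr -/(dot theta theta) -enorm_sqr t1 expr1n mulr1.
Qed.

Lemma offnorm_sub_axis x u theta i : tnth theta i != 0 :> R ->
  (forall j, tnth x j = enorm x * tnth theta j :> R) ->
  offnorm theta i (subRn x u) = offnorm theta i u.
Proof.
move=> ti xt; congr Num.sqrt; apply: eq_bigr => j _.
rewrite /offaxis !tnth_mktuple !xt -[RHS]sqrrN; congr (_ ^+ 2).
by field.
Qed.
End Direction.

Section Chain.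
Context {R : realType} {d' : nat}.
Local Notation d := d'.+1.
Local Notation leb := (@lebesgue_Rn R d).
Local Notation mu := (@lebesgue_measure R).
Local Notation mR := (measurableTypeR R).
Implicit Types x y u theta : Rn R d.

(** A vector of axial part a and squared transversal part at most rho is hardly
    longer than a when rho is small compared with a.  The bound by tau keeps lengths
    in a range of scale tau; the bound by 1 limits the exponential cost. *)
Lemma near_axis (a U rho tau : R) : 0 < tau -> tau / 2 <= a -> 0 <= U ->
  U ^+ 2 <= a ^+ 2 + rho -> rho <= tau ^+ 2 / 100 -> rho <= tau / 100 ->
  U <= a + tau / 100 /\ U <= a + 1 / 100.
Proof.
move=> t0 ta U0 Ua r1 r2; split; rewrite -ler_sqr ?nnegrE//; try lra;
  apply: le_trans Ua _; rewrite sqrrD.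
  have h : 0 <= (a - tau / 2) * tau by rewrite mulr_ge0 ?subr_ge0 // ltW.
  by have := sqr_ge0 (tau / 100); nra.
Qed.

(** One step of the chain.  The slant of u is within tau / 20 of the excess of |x|
    over (n + 2) tau, plus 3 tau / 4.  Whatever the position of |x| in its
    interval, this makes u long enough and puts |x - u| in the preceding interval
    of length tau.  The width min (tau, sqrt tau) makes the squared transversal
    part at most tau / 100, so each of the two lengths exceeds its axial part by
    at most 1 / 100. *)
Lemma tube_geometry x u theta i (n : nat) (tau : R) : enorm theta = 1 ->
  1 <= d%:R * (tnth theta i : R) ^+ 2 ->
  (forall j, tnth x j = enorm x * tnth theta j :> R) -> 0 < tau ->
  n.+2%:R * tau <= enorm x -> enorm x <= n.+3%:R * tau ->
  `|slant theta i u - (enorm x - n.+2%:R * tau + 3 / 4 * tau)| <= tau / 20 ->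
  offnorm theta i u <= Num.min tau (Num.sqrt tau) / 10 ->
  [/\ tau / 2 <= enorm u, enorm u <= 2 * tau,
      n.+1%:R * tau <= enorm (subRn x u), enorm (subRn x u) <= n.+2%:R * tau &
      enorm u + enorm (subRn x u) <= enorm x + 1].
Proof.
move=> t1 ti xt tau0 x1 x2 su ou.
have ti0 : tnth theta i != 0 :> R.
  by apply: contraTneq ti => ->; rewrite expr0n mulr0 -ltNge.
set r := enorm x in x1 x2 su *; set rho := offnorm theta i u in ou *.
have rho0 : 0 <= rho by exact: offnorm_ge0.
have [rho1 rho2] : rho <= tau / 10 /\ rho <= Num.sqrt tau / 10.
  by split; apply: le_trans ou _; rewrite ler_pM2r// ge_min lexx ?orbT.
have r1 : rho ^+ 2 <= tau ^+ 2 / 100.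
  apply: (@le_trans _ _ ((tau / 10) ^+ 2)); last by rewrite exprMn; lra.
  by rewrite ler_sqr ?nnegrE//; lra.
have r2 : rho ^+ 2 <= tau / 100.
  apply: (@le_trans _ _ ((Num.sqrt tau / 10) ^+ 2)).
    by rewrite ler_sqr ?nnegrE// mulr_ge0// sqrtr_ge0.
  by rewrite exprMn sqr_sqrtr; lra.
have du := dot_slant t1 ti u; rewrite -/rho in du.
set a := dot u theta in du *.
have dy : dot (subRn x u) theta = r - a by rewrite dot_subl (dot_direction t1 xt).
move: su du; rewrite !ler_norml => /andP[su1 su2] /andP[du1 du2].
have uU : enorm u ^+ 2 <= a ^+ 2 + rho ^+ 2.
  by have := transversal_le t1 ti u; rewrite -/a -/rho; lra.
have yU : enorm (subRn x u) ^+ 2 <= (r - a) ^+ 2 + rho ^+ 2.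
  by have := transversal_le t1 ti (subRn x u); rewrite dy offnorm_sub_axis// -/rho; lra.
have aU : a <= enorm u by have := dot_le u theta; rewrite t1 mulr1.
have aY : r - a <= enorm (subRn x u).
  by have := dot_le (subRn x u) theta; rewrite t1 mulr1 dy.
have n2 : n.+2%:R * tau = n.+1%:R * tau + tau.
  by rewrite -(natr1 n.+1) mulrDl mul1r.
have n3 : n.+3%:R * tau = n.+2%:R * tau + tau.
  by rewrite -(natr1 n.+2) mulrDl mul1r.
have n1 : 1 * tau <= n.+1%:R * tau by rewrite ler_pM2r// ler1n.
have [|H1 H2] := near_axis tau0 _ (enorm_ge0 u) uU r1 r2; first lra.
have [|H3 H4] := near_axis tau0 _ (enorm_ge0 (subRn x u)) yU r1 r2; first lra.
by split; lra.
Qed.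

(** Volume of the tube of [tube_geometry], cut out by an interval of half-width
    tau / (20 d) for the coordinate i and by intervals of half-width
    min (tau, sqrt tau) / (10 d) for the other d - 1 coordinates. *)
Definition tube_volume (tau : R) : R :=
  tau / (10 * d%:R) * (Num.min tau (Num.sqrt tau) / (5 * d%:R)) ^+ d'.

(** Each further convolution restricts the last increment to a tube; this costs
    the infimum K of f exp (m |.|) at scale tau, the volume of the tube, and a
    factor exp (- m) for the length lost by leaving the straight line. *)
Lemma conv_pow_chain (f : Rn R d -> R) (m K tau : R) :
  measurable_fun setT f -> (forall x, 0 <= f x) ->
  0 <= m -> 0 <= K -> 0 < tau ->
  (forall u, tau / 2 <= enorm u -> enorm u <= 2 * tau ->
     K * expR (- m * enorm u) <= f u) ->
  forall n x, n.+1%:R * tau <= enorm x -> enorm x <= n.+2%:R * tau ->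
  ((K * (K * expR (- m) * tube_volume tau) ^+ n * expR (- m * enorm x))%:E
   <= conv_pow f n.+1 x)%E.
Proof.
move=> mf f0 m0 K0 tau0 fK; elim=> [|n IH] x x1 x2.
  rewrite expr0 mulr1 lee_fin; apply: fK => //.
  by move: x1; rewrite mul1r; lra.
set Q := K * expR (- m) * tube_volume tau.
have x0 : 0 < enorm x by apply: lt_le_trans x1; rewrite mulr_gt0.
have [theta t1 xt] := direction x0.
have [i ti] := unit_coord (ltn0Sn d') t1.
have ti0 : tnth theta i != 0 :> R.
  by apply: contraTneq ti => ->; rewrite expr0n mulr0 -ltNge.
(* A bound h for each off-axis coordinate gives d h for the off-axis norm, and
   an error e in u_i gives an error at most d e in the slant. *)
pose h : R := Num.min tau (Num.sqrt tau) / (10 * d%:R).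
pose e : R := tau / (20 * d%:R).
pose A : R := enorm x - n.+2%:R * tau + 3 / 4 * tau.
pose phi (a : R) : R := (`|a - A * tnth theta i| <= e)%R%:R.
pose psi (a t : R) : R := (`|t| <= h)%R%:R.
have h0 : 0 <= h.
  by rewrite divr_ge0 ?mulr_ge0// le_min (ltW tau0) sqrtr_ge0.
have e0 : 0 <= e by rewrite divr_ge0 ?mulr_ge0// ltW.
have mphi : measurable_fun setT phi.
  apply: (measurableT_comp (measurable_abs_le e)).
  exact: measurable_funB.
have mpsi : measurable_fun setT (fun p : mR * mR => psi p.1 p.2).
  by apply: (measurableT_comp (measurable_abs_le h)).
pose T (u : Rn R d) : R := phi (tnth u i) *
  \prod_(j | j != i) psi (tnth u i) (tnth u j - tnth theta j / tnth theta i * tnth u i).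
have IT : (\int[leb]_u (T u)%:E = (tube_volume tau)%:E)%E.
  rewrite (integral_shear i (W := fun=> 2 * h)
     (fun j => tnth theta j / tnth theta i : R))//; last first.
    by move=> a; exact: integral_indic_abs.
  transitivity (\int[mu]_a (((2 * h) ^+ d')%:E * (phi a)%:E))%E.
    by apply: eq_integral => a _; rewrite -EFinM mulrC.
  rewrite ge0_integralZl//; last 3 first.
  - exact/measurable_EFinP.
  - by move=> a _; rewrite lee_fin ler0n.
  - by rewrite lee_fin exprn_ge0// mulr_ge0.
  rewrite (@integral_shift _ (A * tnth theta i) (fun t => ((`|t| <= e)%R%:R)%:E)); last 2 first.
  - by apply/measurable_EFinP; exact: measurable_abs_le.
  - by move=> t; rewrite lee_fin ler0n.
  rewrite integral_indic_abs// -EFinM /tube_volume /h /e mulrC; congr (_%:E).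
  have dn : d%:R != 0 :> R by rewrite pnatr_eq0.
  by move: (d%:R) dn => D dn; congr (_ * _ ^+ _); field.
have mh := measurable_conv_pow mf f0 n.
have T0 u : 0 <= T u.
  by rewrite /T mulr_ge0 ?ler0n//; apply: prodr_ge0 => j _; exact: ler0n.
have mT : measurable_fun setT (fun u => (T u)%:E).
  by apply/measurable_EFinP; exact: measurable_shear.
have subK y : subRn x (subRn x y) = y.
  by apply/eq_from_tnth => j; rewrite !tnth_mktuple opprB addrC subrK.
pose G u := ((f u)%:E * conv_pow f n.+1 (subRn x u))%E.
have mG : measurable_fun setT G.
  apply: emeasurable_funM; first exact/measurable_EFinP.
  by apply: (measurableT_comp mh); exact: measurable_subRn.
have G0 u : (0 <= G u)%E by rewrite mule_ge0 ?lee_fin// conv_pow_ge0.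
rewrite conv_powS (_ : (\int[leb]_y _)%E = \int[leb]_u G u)%E; last first.
  rewrite -[RHS](integral_subRn x mG G0).
  by apply: eq_integral => y _; rewrite /G subK.
pose c := K * Q ^+ n * expR (- m * enorm x) * (K * expR (- m)).
have Q0 : 0 <= Q.
  rewrite /Q !mulr_ge0 ?expR_ge0// ?divr_ge0 ?mulr_ge0 ?(ltW tau0)//.
  by rewrite exprn_ge0// divr_ge0 ?mulr_ge0// le_min (ltW tau0) sqrtr_ge0.
have c0 : 0 <= c by rewrite /c !mulr_ge0 ?expR_ge0 ?exprn_ge0.
apply: (@le_trans _ _ (\int[leb]_u (c%:E * (T u)%:E))%E).
  rewrite ge0_integralZl// ?lee_fin//; last first.
    by move=> u _; rewrite lee_fin.
  rewrite IT -EFinM lee_fin /c /Q exprS le_eqVlt; apply/orP; left; apply/eqP.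
  by ring.
apply: ge0_le_integral => //.
- by move=> u _; rewrite mule_ge0 ?lee_fin.
- exact: emeasurable_funM.
move=> u _; have [->|Tu] := eqVneq (T u) 0; first by rewrite mule0.
have T1 : T u <= 1.
  apply: mulr_ile1; rewrite ?ler0n ?prodr_ge0//; first by rewrite /phi lern1 leq_b1.
  by apply: prodr_ile1 => j _; rewrite /psi ler0n lern1 leq_b1.
move: Tu; rewrite /T mulf_eq0 negb_or => /andP[phiu /prodf_neq0 psiu].
have D0 : 0 < d%:R :> R by rewrite ltr0n.
have Ti : 0 < `|(tnth theta i)^-1 : R| by rewrite normr_gt0 invr_eq0.
have su : `|slant theta i u - A| <= tau / 20.
  move: phiu; rewrite /phi pnatr_eq0 eqb0 negbK => phiu.
  rewrite (_ : slant theta i u - A = (tnth u i - A * tnth theta i) / tnth theta i); last first.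
    by rewrite /slant; field.
  rewrite normrM; apply: (@le_trans _ _ (e * d%:R)).
    by apply: ler_pM => //; exact: (theta_inv_le ti).
  by rewrite /e mulrC (_ : _ * (_ / _) = tau / 20)//; field; exact: lt0r_neq0.
have ou : offnorm theta i u <= Num.min tau (Num.sqrt tau) / 10.
  apply: (@le_trans _ _ (d%:R * h)).
    apply: offnorm_le => // j ji; have := psiu j ji.
    by rewrite /psi pnatr_eq0 eqb0 negbK.
  rewrite /h (_ : _ * (_ / _) = Num.min tau (Num.sqrt tau) / 10)//.
  by field; exact: lt0r_neq0.
have [u1 u2 y1 y2 uy] := tube_geometry t1 ti xt tau0 x1 x2 su ou.
apply: (@le_trans _ _ c%:E); first by rewrite -[leRHS]mule1; apply: lee_wpmul2l; rewrite lee_fin.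
apply: (@le_trans _ _ ((K * expR (- m * enorm u))%:E *
   (K * Q ^+ n * expR (- m * enorm (subRn x u)))%:E)%E).
  rewrite -EFinM lee_fin /c.
  rewrite [leLHS](_ : _ = K * K * Q ^+ n * expR (- m * (enorm x + 1))); last first.
    by rewrite mulrDr mulr1 expRD; ring.
  rewrite [leRHS](_ : _ = K * K * Q ^+ n * expR (- m * (enorm u + enorm (subRn x u)))); last first.
    by rewrite mulrDr expRD; ring.
  apply: ler_wpM2l; first by rewrite !mulr_ge0// exprn_ge0.
  by rewrite ler_expR !mulNr lerN2 ler_wpM2l.
apply: lee_pmul; rewrite ?lee_fin ?mulr_ge0 ?expR_ge0 ?exprn_ge0//.
- exact: fK.
- exact: IH.
Qed.
End Chain.

(** * Elementary real bounds and dyadic shells *)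

Section RealBounds.
Context {R : realType}.

(** 1 + t <= exp t at t = e x / k, raised to the power k. *)
Lemma powR_le_expR (k e : R) : 0 <= k -> 0 < e ->
  exists2 K : R, 0 < K & forall x, 0 <= x -> x `^ k <= K * expR (e * x).
Proof.
move=> k0 e0; have [->|kn0] := eqVneq k 0.
  exists 1 => // x x0; rewrite powRr0 mul1r -expR0 ler_expR.
  by rewrite mulr_ge0// ltW.
have kp : 0 < k by rewrite lt_neqAle eq_sym kn0.
exists ((k / e) `^ k); first by rewrite powR_gt0// divr_gt0.
move=> x x0.
rewrite (_ : e * x = e * x / k * k); last by rewrite divfK.
have ke0 : 0 <= k / e by rewrite divr_ge0 ?(ltW e0).
rewrite expRM -powRM ?expR_ge0//.
have xE : x = k / e * (e * x / k) by field; rewrite (gt_eqF kp) (gt_eqF e0).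
have xle : x <= k / e * expR (e * x / k).
  rewrite [leLHS]xE; apply: ler_wpM2l => //.
  by apply: le_trans (expR_ge1Dx _); rewrite lerDr.
by apply: ge0_ler_powR => //; rewrite nnegrE // mulr_ge0 ?expR_ge0.
Qed.

Lemma powRN_anti (a b g : R) : 0 <= g -> 0 < a -> a <= b -> b `^ (- g) <= a `^ (- g).
Proof.
move=> g0 a0 ab; have b0 : 0 < b by exact: lt_le_trans ab.
rewrite !powRN lef_pV2 ?posrE ?powR_gt0//.
by apply: ge0_ler_powR => //; rewrite nnegrE ltW.
Qed.

Lemma eseries_le_bound (a : nat -> R) (B : R) : (forall k, 0 <= a k) ->
  (forall n, \sum_(0 <= k < n) a k <= B) ->
  (\sum_(0 <= k <oo) (a k)%:E <= B%:E)%E.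
Proof.
move=> a0 aB; apply: lime_le.
  by apply: is_cvg_nneseries => k _ _; rewrite lee_fin.
by apply: nearW => n; rewrite sumEFin lee_fin.
Qed.

(** Take the least k for which the first inequality holds. *)
Lemma dyadic_shell (r t : R) : 0 < t -> t <= r ->
  exists k, r / 2 ^+ k.+1 <= t /\ t <= r / 2 ^+ k.
Proof.
move=> t0 tr; have r0 : 0 < r by exact: lt_le_trans tr.
have ex : exists k, r / 2 ^+ k.+1 <= t.
  have := archi_boundP (ltW (divr_gt0 r0 t0)); set b := Num.bound _ => bP.
  exists b; rewrite ler_pdivrMr ?exprn_gt0// -ler_pdivrMl// mulrC.
  apply: le_trans (ltW bP) _; rewrite -natrX ler_nat ltnW//.
  by apply: (leq_ltn_trans (leqnSn _)); exact: ltn_expl.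
case: (ex_minnP ex) => k kt kmin; exists k; split => //.
case: k kt kmin => [|k] kt kmin; first by rewrite expr0 divr1.
rewrite leNgt; apply/negP => /ltW /kmin; by rewrite ltnn.
Qed.

(** On the dyadic shell of radius r / 2^k the integrand is at most
    (r / 2^(k+1))^(-g), and the volume is at most V (r / 2^k)^D, so the shells form
    a geometric series of ratio 2^(-(D - g)).  Stated for an arbitrary size
    function N because it serves both the singularity of |y|^(-g) in R^d and the
    weights (1 + |a|)^k with k < 0 on the line. *)
Lemma integral_shells {disp} {T : measurableType disp} {mu : {measure set T -> \bar R}}
    (N : T -> R) (V D g : R) : 0 <= g -> g < D -> 0 <= V ->
  measurable_fun setT N -> (forall y, 0 <= N y) ->
  (forall h, 0 < h -> (\int[mu]_y ((N y <= h)%R%:R)%:E <= (V * h `^ D)%:E)%E) ->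
  exists2 C : R, 0 < C & forall (r : R) (F : T -> R), 0 < r ->
    measurable_fun setT F -> (forall y, 0 <= F y) ->
    (forall y, r < N y -> F y = 0) ->
    (forall y, 0 < N y -> F y <= N y `^ (- g)) ->
    (forall y, N y = 0 -> F y <= r `^ (- g)) ->
    (\int[mu]_y (F y)%:E <= (C * r `^ (D - g))%:E)%E.
Proof.
move=> g0 gD V0 mN N0 muV.
pose q : R := 2 `^ (- (D - g)).
have q0 : 0 < q by rewrite powR_gt0.
have q1 : q < 1.
  rewrite /q /powR pnatr_eq0 /= expR_lt1 mulNr oppr_lt0 mulr_gt0 ?subr_gt0//.
  by rewrite ln_gt0// ltr1n.
pose C := (V + 1) * 2 `^ g / (1 - q).
exists C; first by rewrite divr_gt0 ?mulr_gt0 ?powR_gt0 ?subr_gt0// ltr_wpDl.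
move=> r F r0 mF F0 Fr Fg Fz.
pose b k := r / 2 ^+ k.
have b0 k : 0 < b k by rewrite divr_gt0 ?exprn_gt0.
pose a k y : \bar R := ((b k.+1) `^ (- g) * (N y <= b k)%R%:R)%:E.
have mball h := measurable_indic_le h mN.
have ma k : measurable_fun setT (a k).
  by apply/measurable_EFinP; apply: measurable_funM.
have a0 k y : (0 <= a k y)%E by rewrite lee_fin mulr_ge0 ?powR_ge0 ?ler0n.
apply: (@le_trans _ _ (\int[mu]_y \sum_(0 <= k <oo) a k y)%E).
  apply: ge0_le_integral => //.
  - by move=> y _; rewrite lee_fin.
  - exact/measurable_EFinP.
  - by apply: ge0_emeasurable_sum => //.
  - move=> y _.
    have key k : (a k y <= \sum_(0 <= k <oo) a k y)%E.
      have := @nneseries_lim_ge R (a ^~ y) xpredT 0 k.+1.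
      rewrite big_nat_recr//= => /(_ (fun n _ _ => a0 n y)); apply: le_trans.
      by rewrite leeDr// sume_ge0.
    have [Nr|rN] := leP (N y) r; last first.
      by rewrite Fr//; apply: nneseries_ge0.
    have [N00|Nn0] := eqVneq (N y) 0.
      apply: le_trans (key 0%N); rewrite lee_fin N00 (ltW (b0 _)) mulr1.
      apply: le_trans (Fz _ N00) _; apply: powRN_anti => //.
      rewrite /b expr1 ler_pdivrMr// ler_peMr ?(ltW r0)//.
      by rewrite ler1n.
    have Np : 0 < N y by rewrite lt_neqAle eq_sym Nn0 N0.
    have [k [k1 k2]] := dyadic_shell Np Nr.
    apply: le_trans (key k); rewrite lee_fin k2 mulr1.
    by apply: le_trans (Fg _ Np) _; apply: powRN_anti.
rewrite integral_nneseries//.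
have bk k : b k = r * 2 `^ (- k%:R) by rewrite /b powRN powR_mulrn.
apply: (@le_trans _ _ (\sum_(0 <= k <oo) ((V * 2 `^ g * r `^ (D - g) * q ^+ k)%:E))%E).
  apply: lee_nneseries; first by move=> k *; apply: integral_ge0.
  move=> k _; rewrite /a; under eq_integral do rewrite EFinM.
  rewrite ge0_integralZl//; last 2 first.
  - exact/measurable_EFinP.
  - by rewrite lee_fin powR_ge0.
  apply: (@le_trans _ _ ((b k.+1 `^ (- g))%:E * (V * b k `^ D)%:E)%E).
    by apply: lee_wpmul2l; [rewrite lee_fin powR_ge0|exact: muV].
  rewrite -EFinM lee_fin le_eqVlt; apply/orP; left; apply/eqP.
  rewrite !bk !powRM ?powR_ge0 ?(ltW r0)// -!powRrM /q -powR_mulrn ?powR_ge0// -powRrM.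
  rewrite powRD; last by rewrite (gt_eqF r0) implybT.
  rewrite (_ : - k.+1%:R * - g = g + k%:R * g); last by rewrite -natr1; ring.
  rewrite powRD; last by rewrite pnatr_eq0 implybT.
  rewrite (_ : - (D - g) * k%:R = k%:R * g + - k%:R * D); last by ring.
  rewrite powRD; last by rewrite pnatr_eq0 implybT.
  ring.
apply: eseries_le_bound.
  by move=> k; rewrite !mulr_ge0 ?powR_ge0 ?exprn_ge0 ?(ltW q0).
move=> n; have := @geometric_le_lim R n (V * 2 `^ g * r `^ (D - g)) q.
rewrite /series /=  => h; apply: le_trans (h _ _ _) _ => //.
- by rewrite !mulr_ge0 ?powR_ge0.
- by rewrite gtr0_norm.
rewrite /C [leLHS]mulrAC ler_wpM2r ?powR_ge0// ler_pM2r ?invr_gt0 ?subr_gt0//.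
by rewrite ler_wpM2r ?powR_ge0// lerDl.
Qed.

End RealBounds.

Section ExpPow.
Context {R : realType}.
Local Notation mu := (@lebesgue_measure R).
Local Notation mR := (measurableTypeR R).

Lemma measurable_1abs : measurable_fun setT (fun a : mR => 1 + `|a| : R).
Proof.
apply: measurable_funD => //; exact: normr_measurable.
Qed.

Lemma measurable_pow1abs (k : R) :
  measurable_fun setT (fun a : mR => (1 + `|a|) `^ k).
Proof.
apply: (@measurableT_comp _ _ _ _ _ _ (fun x : R => x `^ k)).
  exact: measurable_powR.
exact: measurable_1abs.
Qed.

Lemma measurable_expabs (c : R) :
  measurable_fun setT (fun a : mR => expR (- c * `|a|)).
Proof.
apply: (@measurableT_comp _ _ _ _ _ _ (@expR R)); first exact: measurable_expR.
by apply: measurable_funM => //.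
Qed.

Lemma abs1_gt0 (a : R) : 0 < 1 + `|a|. Proof. by rewrite ltr_pwDl. Qed.

(** The scale of the exponential is 1 / s.  For k >= 0 the power is bounded by
    s^(-k) times a part of the exponential; for k < 0 it is integrated directly up
    to 1 + |a| = 1 / s, and is at most s^(-k) beyond. *)
Lemma integral_pow_exp (k m : R) : -1 < k -> 0 < m ->
  exists2 C : R, 0 < C & forall s, 0 < s -> s <= m ->
    (\int[mu]_a ((1 + `|a|) `^ k * expR (- (s / 2) * `|a|))%:E
     <= (C * s `^ (- (k + 1)))%:E)%E.
Proof.
move=> k1 m0.
have mF s : measurable_fun setT (fun a : mR => ((1 + `|a|) `^ k * expR (- (s / 2) * `|a|))%:E).
  apply/measurable_EFinP; apply: measurable_funM; first exact: measurable_pow1abs.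
  exact: measurable_expabs.
have [k0|k0] := leP 0 k.
  have [K K0 Kle] := @powR_le_expR R k (1/4) k0 ltac:(lra).
  exists (8 * K * expR (m / 4)); first by rewrite !mulr_gt0// expR_gt0.
  move=> s s0 sm.
  apply: (@le_trans _ _ (\int[mu]_a ((K * expR (m / 4) * s `^ (- k))%:E *
      (expR (- (s / 4) * `|a|))%:E))%E).
    apply: ge0_le_integral => //.
    - apply: emeasurable_funM => //; apply/measurable_EFinP; exact: measurable_expabs.
    - move=> a _; rewrite -EFinM lee_fin.
      have a1 := abs1_gt0 a.
      have h : (1 + `|a|) `^ k <= s `^ (- k) * (K * expR (m / 4 + s / 4 * `|a|)).
        rewrite powRN ler_pdivlMl ?powR_gt0// -powRM ?(ltW s0) ?(ltW a1)//.
        apply: le_trans (Kle _ (mulr_ge0 (ltW s0) (ltW a1))) _.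
        apply: ler_wpM2l; [exact: ltW|rewrite ler_expR].
        by rewrite mulrDr mulr1; lra.
      rewrite [leRHS](_ : _ = s `^ (- k) * (K * expR (m / 4 + s / 4 * `|a|)) *
          expR (- (s / 2) * `|a|)); last first.
        rewrite (_ : - (s / 4) * `|a| = s / 4 * `|a| + - (s / 2) * `|a|); last by field.
        by rewrite !expRD; ring.
      by apply: ler_wpM2r => //; exact: expR_ge0.
  rewrite ge0_integralZl//; last 2 first.
  - by apply/measurable_EFinP; exact: measurable_expabs.
  - by rewrite lee_fin !mulr_ge0 ?powR_ge0 ?expR_ge0 ?(ltW K0).
  rewrite integral_exp_abs ?divr_gt0// -EFinM lee_fin.
  rewrite opprD powRD; last by rewrite (gt_eqF s0) implybT.
  rewrite (powR_inv1 (ltW s0)) le_eqVlt; apply/orP; left; apply/eqP.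
  by field; rewrite gt_eqF.
have [||||C C0 CP] := @integral_shells R _ _ mu (fun a : mR => 1 + `|a|) 2 1 (- k)
  _ _ _ measurable_1abs (fun a => ltW (abs1_gt0 a)).
- lra.
- lra.
- by [].
- move=> h h0; rewrite powRr1 ?(ltW h0)// -(integral_indic_abs (ltW h0)).
  apply: ge0_le_integral => //.
  + apply/measurable_EFinP.
    exact: (measurable_indic_le h measurable_1abs).
  + by apply/measurable_EFinP; exact: measurable_abs_le.
  + move=> a _; rewrite lee_fin ler_nat; case: (leP (1 + _) h) => //= H.
    by rewrite (_ : (`|a| <= h) = true)//; lra.
exists (C + 4); first by rewrite addr_gt0.
move=> s s0 sm.
have is0 : 0 < s^-1 by rewrite invr_gt0.
pose F (a : R) : R := (1 + `|a|) `^ k * (1 + `|a| <= s^-1)%R%:R.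
have mFF : measurable_fun setT F.
  apply: measurable_funM; first exact: measurable_pow1abs.
  exact: (measurable_indic_le s^-1 measurable_1abs).
have F0 a : 0 <= F a by rewrite mulr_ge0 ?powR_ge0 ?ler0n.
apply: (@le_trans _ _ (\int[mu]_a ((F a)%:E +
    (s `^ (- k))%:E * (expR (- (s / 2) * `|a|))%:E))%E).
  apply: ge0_le_integral => //.
  - apply: emeasurable_funD; first exact/measurable_EFinP.
    by apply: emeasurable_funM => //; apply/measurable_EFinP; exact: measurable_expabs.
  - move=> a _; rewrite -EFinM -EFinD lee_fin /F.
    have a1 := abs1_gt0 a.
    have [H|H] := leP (1 + `|a|) s^-1.
      rewrite mulr1 -[leLHS]addr0; apply: lerD; last by rewrite mulr_ge0 ?powR_ge0 ?expR_ge0.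
      rewrite ler_piMr ?powR_ge0// -expR0 ler_expR mulNr oppr_le0.
      by rewrite mulr_ge0// divr_ge0// ltW.
    rewrite mulr0 add0r; apply: ler_wpM2r; first exact: expR_ge0.
    have k0' : 0 <= - k by rewrite oppr_ge0 ltW.
    have := @powRN_anti R s^-1 (1 + `|a|) (- k) k0' is0 (ltW H).
    by rewrite opprK -[s^-1](powR_inv1 (ltW s0)) -powRrM mulN1r.
rewrite ge0_integralD//; last 4 first.
- by move=> a _; rewrite lee_fin.
- exact/measurable_EFinP.
- by move=> a _; rewrite mule_ge0 ?lee_fin ?powR_ge0 ?expR_ge0.
- by apply: emeasurable_funM => //; apply/measurable_EFinP; exact: measurable_expabs.
rewrite ge0_integralZl//; last 2 first.
- by apply/measurable_EFinP; exact: measurable_expabs.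
- by rewrite lee_fin powR_ge0.
rewrite integral_exp_abs ?divr_gt0// -EFinM.
have -> : (C + 4) * s `^ (- (k + 1)) = C * s^-1 `^ (1 - - k) + s `^ (- k) * (2 / (s / 2)).
  rewrite -powR_inv1 ?(ltW s0)// -powRrM (_ : -1 * (1 - - k) = - (k + 1)); last by ring.
  rewrite mulrDl; congr (_ + _).
  rewrite opprD powRD; last by rewrite (gt_eqF s0) implybT.
  by rewrite (powR_inv1 (ltW s0)); field; rewrite gt_eqF.
rewrite EFinD; apply: leeD => //; apply: CP => //.
- by move=> a H; rewrite /F leNgt H /= mulr0.
- move=> a _; rewrite /F opprK ler_piMr ?powR_ge0//; by rewrite lern1 leq_b1.
- by move=> a H; have := abs1_gt0 a; rewrite H ltxx.
Qed.
End ExpPow.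

(** * Mass of the exponentially tilted profile *)

Section TiltedMass.
Context {R : realType} {d' : nat}.
Local Notation d := d'.+1.
Local Notation leb := (@lebesgue_Rn R d).
Local Notation mu := (@lebesgue_measure R).
Local Notation mR := (measurableTypeR R).
Implicit Types x y u theta : Rn R d.

(** Part of the decay is kept along y (rate s / 2, needed for integrability) and
    part across theta (rate m / 4, uniform in s).  The latter survives when s is
    close to m, since then the decay along y also controls |y| - p <= 2 |y|. *)
Lemma tilt_exponent (m s U p : R) : 0 < s -> s <= m -> `|p| <= U ->
  - m * U + (m - s) * p <= - (s / 2) * U - m / 4 * (U - p).
Proof.
move=> s0 sm; rewrite ler_norml => /andP[p1 p2].
(* The difference is linear in p, so the extreme cases are p = U and p = - U. *)
have [h|h] := leP 0 (3 / 4 * m - s).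
  have : 0 <= (3 / 4 * m - s) * (U - p) by rewrite mulr_ge0// subr_ge0.
  have : 0 <= s * U by apply: mulr_ge0; lra.
  lra.
have : 0 <= (s - 3 / 4 * m) * (U + p) by apply: mulr_ge0; lra.
have : 0 <= (m - s) * U by apply: mulr_ge0; lra.
lra.
Qed.

(** With v = sqrt b and t = w / v, the transversal exponent w^2 / (b + w) is at
    least t^2 / (1 + t) >= t - 1.  Thus the Gaussian decay at scale sqrt b is
    weakened to an exponential one, which splits over the coordinates and has
    explicit integrals. *)
Lemma transversal_gain (w b : R) : 0 <= w -> 1 <= b ->
  (w / Num.sqrt b - 1) * (b + w) <= w ^+ 2.
Proof.
move=> w0 b1; have b0 : 0 <= b by lra.
rewrite -(sqr_sqrtr b0); set v := Num.sqrt b.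
have v1 : 1 <= v by rewrite -(sqrtr1 R) ler_sqrt.
have v0 : 0 < v by lra.
rewrite (sqrtr_sqr v) (gtr0_norm v0).
(* Complete the square in w. *)
suff : 0 <= ((v - 1) * (w - v / 2) ^+ 2 + v ^+ 3 - (v - 1) * v ^+ 2 / 4) / v.
  rewrite (_ : _ / v = w ^+ 2 - (w / v - 1) * (v ^+ 2 + w)) ?subr_ge0//.
  by field; rewrite gt_eqF.
rewrite divr_ge0 ?(ltW v0)//.
have h1 : 0 <= (v - 1) * (w - v / 2) ^+ 2 by rewrite mulr_ge0 ?sqr_ge0 ?subr_ge0.
have h2 : 0 <= v ^+ 3 by rewrite exprn_ge0// ltW.
have h3 : 0 <= v ^+ 2 by rewrite sqr_ge0.
rewrite (_ : (v - 1) * v ^+ 2 / 4 = v ^+ 3 / 4 - v ^+ 2 / 4); last by field.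
lra.
Qed.

(** A product bound of the form required by [integral_shear].  The deviation
    |y| - y . theta is at least |w|^2 / (2 d |y|) for the off-axis part w, while |y|
    is at most d (1 + |y_i| + |w|). *)
Lemma far_bound (m g s : R) theta i y : 0 < s -> s <= m -> 0 <= g ->
  enorm theta = 1 -> 1 <= d%:R * (tnth theta i : R) ^+ 2 -> 1 <= enorm y ->
  expR (- m * enorm y + (m - s) * dot y theta) * enorm y `^ (- g) <=
  expR (m / (8 * d%:R ^+ 2)) * 2 `^ g *
  (expR (- (s / 2) * `|tnth y i : R|) * (1 + `|tnth y i : R|) `^ (- g)) *
  \prod_(j | j != i) expR (- (m / (8 * d%:R ^+ 3) / Num.sqrt (1 + `|tnth y i : R|))
     * `|tnth y j - tnth theta j / tnth theta i * tnth y i : R|).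
Proof.
move=> s0 sm g0 t1 ti y1.
set U := enorm y in y1 *; set a := `|tnth y i : R|; set b := 1 + a.
have aU : a <= U by exact: abs_tnth_le.
have a0 : 0 <= a by rewrite /a.
have b1 : 1 <= b by rewrite /b; lra.
have m0 : 0 < m by lra.
pose w := offnorm theta i y; have w0 : 0 <= w by exact: offnorm_ge0.
pose D : R := d%:R; have D1 : 1 <= D by rewrite ler1n.
have D0 : 0 < D by lra.
set p := dot y theta.
have tr : w ^+ 2 <= D * (U ^+ 2 - p ^+ 2) by exact: transversal_ge.
have pU : `|p| <= U.
  rewrite -ler_sqr ?nnegrE ?enorm_ge0// real_normK ?num_real// -subr_ge0.
  by rewrite -(pmulr_rge0 _ D0); apply: le_trans tr; exact: sqr_ge0.
have Ubw : U <= D * (b + w).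
  apply: le_trans (enorm_le_slant t1 ti y) _; rewrite mulrDr; apply: lerD.
    rewrite /slant normrM mulrC; apply: ler_pM => //; first exact: theta_inv_le.
    by rewrite -/a /b; lra.
  by rewrite ler_peMl.
have gain : w / Num.sqrt b - 1 <= 2 * D ^+ 2 * (U - p).
  have bw : 0 < b + w by lra.
  rewrite -(ler_pM2r bw); apply: le_trans (transversal_gain w0 b1) _.
  apply: le_trans tr _.
  have [p1 p2] : - U <= p /\ p <= U by move: pU; rewrite ler_norml => /andP.
  rewrite (_ : 2 * D ^+ 2 * (U - p) * (b + w) = D * ((U - p) * (2 * (D * (b + w))))); last by ring.
  rewrite ler_pM2l// subr_sqr; apply: ler_wpM2l; first lra.
  lra.
pose S := \sum_(j | j != i) `|offaxis theta i y j|.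
have Sw : S <= D * w by exact: sum_offaxis_le.
have sb0 : 0 < Num.sqrt b by rewrite sqrtr_gt0; lra.
rewrite -expR_sum.
rewrite (_ : \sum_(j | j != i) _ = - (m / (8 * D ^+ 3) / Num.sqrt b) * S); last by rewrite /S mulr_sumr.
have Ug : U `^ (- g) <= 2 `^ g * b `^ (- g).
  rewrite (_ : 2 `^ g = 2^-1 `^ (- g)); last by rewrite -powR_inv1// -powRrM mulN1r opprK.
  rewrite -powRM; last 2 first.
  - by rewrite invr_ge0.
  - lra.
  by apply: powRN_anti => //; rewrite /b; lra.
rewrite [leRHS](_ : _ = (expR (m / (8 * D ^+ 2)) * expR (- (s / 2) * a) *
   expR (- (m / (8 * D ^+ 3) / Num.sqrt b) * S)) * (2 `^ g * b `^ (- g))); last by ring.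
rewrite -!expRD; apply: ler_pM => //; rewrite ?expR_ge0 ?powR_ge0// ler_expR.
apply: le_trans (tilt_exponent s0 sm pU) _.
have h1 : s / 2 * a <= s / 2 * U by rewrite ler_wpM2l// divr_ge0// ltW.
have h2 : m / (8 * D ^+ 3) / Num.sqrt b * S - m / (8 * D ^+ 2) <= m / 4 * (U - p).
  apply: (@le_trans _ _ (m / (8 * D ^+ 2) * (w / Num.sqrt b - 1))).
    rewrite mulrBr mulr1 lerD2r.
    rewrite (_ : m / (8 * D ^+ 2) * (w / Num.sqrt b) = m / (8 * D ^+ 3) / Num.sqrt b * (D * w)).
      by apply: ler_wpM2l => //; rewrite !divr_ge0 ?mulr_ge0 ?exprn_ge0 ?sqrtr_ge0 ?(ltW m0) ?(ltW D0).
    by field; rewrite !gt_eqF.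
  rewrite (_ : m / 4 * (U - p) = m / (8 * D ^+ 2) * (2 * D ^+ 2 * (U - p))).
    by apply: ler_wpM2l => //; rewrite divr_ge0 ?mulr_ge0 ?exprn_ge0 ?(ltW m0) ?(ltW D0).
  by field; rewrite gt_eqF.
rewrite !mulNr.
move: h1 h2; move: (m / (8 * D ^+ 3) / Num.sqrt b * S) (m / (8 * D ^+ 2)) => X Y.
lra.
Qed.

(** The ball lies in a cube of side 2 h. *)
Lemma integral_ball_le (h : R) : 0 < h ->
  (\int[leb]_y ((enorm y <= h)%R%:R)%:E <= (2 ^+ d * h `^ d%:R)%:E)%E.
Proof.
move=> h0.
have mB : measurable_fun setT (fun t : mR => (`|t| <= h)%R%:R : R).
  exact: measurable_abs_le.
have := @integral_prod_shift R d (fun t => (`|t| <= h)%R%:R) (2 * h) (fun=> 0) mB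
  (fun t => ler0n _ _) (integral_indic_abs (ltW h0)).
rewrite exprMn -(powR_mulrn d (ltW h0)) => <-.
apply: ge0_le_integral => //.
- by apply/measurable_EFinP; apply: measurable_indic_le; exact: measurable_enorm.
- apply/measurable_EFinP; apply: measurable_prodr => j.
  apply: (measurableT_comp mB); apply: measurable_funB => //; exact: measurable_tnth.
- move=> y _; rewrite lee_fin; have [H|H] := leP (enorm y) h.
    rewrite big1// => j _; rewrite subr0 (_ : (_ <= h) = true)//.
    exact: le_trans (abs_tnth_le y j) H.
  by apply: prodr_ge0 => j _; exact: ler0n.
Qed.

(** Inside the unit ball the tilt is absorbed by exp (- m |y|), and |y|^(-g) is
    integrable because g < d.  Outside, the transversal integral in [far_bound]
    contributes (1 + |y_i|)^((d - 1) / 2), and the remaining integral over y_i has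
    order s^(-((d - 1) / 2 - g + 1)). *)
Lemma tilted_mass (m g : R) : 0 < m -> 0 <= g -> g < (d%:R + 1) / 2 ->
  exists2 C : R, 0 < C & forall (f : Rn R d -> R) (theta : Rn R d) (s : R),
    measurable_fun setT f -> (forall u, 0 <= f u) ->
    (forall u, 0 < enorm u -> f u <= expR (- m * enorm u) * enorm u `^ (- g)) ->
    (forall u, enorm u = 0 -> f u <= 1) ->
    enorm theta = 1 -> 0 < s -> s <= m ->
    (\int[leb]_y (f y * expR ((m - s) * dot y theta))%:E
     <= (C * s `^ (- ((d%:R + 1) / 2 - g)))%:E)%E.
Proof.
move=> m0 g0 gd.
have d1 : 1 <= d%:R :> R by rewrite ler1n.
pose rho : R := (d%:R + 1) / 2 - g.
have rho0 : 0 < rho by rewrite subr_gt0.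
(* d' = d - 1 off-axis directions, each of width the square root of the length. *)
pose k : R := d'%:R / 2 - g.
have dE : d%:R = d'%:R + 1 :> R by rewrite natr1.
have kE : k + 1 = rho by rewrite /k /rho dE; field.
have k1 : -1 < k by lra.
have [||C1 C10 C1P] := @integral_shells R _ _ leb (@enorm R d) (2 ^+ d) d%:R g g0 _ _
  measurable_enorm (@enorm_ge0 R d) integral_ball_le.
- lra.
- exact: exprn_ge0.
have [C2 C20 C2P] := integral_pow_exp k1 m0.
pose c : R := m / (8 * d%:R ^+ 3).
have c0 : 0 < c by rewrite divr_gt0// mulr_gt0// exprn_gt0// ltr0n.
pose A : R := expR (m / (8 * d%:R ^+ 2)) * 2 `^ g.
have A0 : 0 <= A by rewrite mulr_ge0 ?expR_ge0 ?powR_ge0.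
exists (C1 * m `^ rho + A * (2 / c) ^+ d' * C2).
  apply: ltr_wpDr; last by rewrite mulr_gt0// powR_gt0.
  by rewrite !mulr_ge0 ?(ltW C20)// exprn_ge0// divr_ge0// ltW.
move=> f theta s mf f0 fE fz t1 s0 sm.
have [i ti] := unit_coord (ltn0Sn d') t1.
pose F y := f y * expR ((m - s) * dot y theta).
have mF : measurable_fun setT F.
  apply: measurable_funM => //.
  apply: (@measurableT_comp _ _ _ _ _ _ (@expR R)); first exact: measurable_expR.
  by apply: measurable_funM => //; exact: measurable_dot.
have F0 y : 0 <= F y by rewrite mulr_ge0 ?expR_ge0.
pose F1 y := F y * (enorm y <= 1)%R%:R.
have mF1 : measurable_fun setT F1.
  by apply: measurable_funM => //; apply: measurable_indic_le; exact: measurable_enorm.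
have F10 y : 0 <= F1 y by rewrite mulr_ge0 ?ler0n.
pose phi (a : R) : R := expR (- (s / 2) * `|a|) * (1 + `|a|) `^ (- g).
pose psi (a t : R) : R := expR (- (c / Num.sqrt (1 + `|a|)) * `|t|).
pose F2 (y : Rn R d) : R := phi (tnth y i) *
  \prod_(j | j != i) psi (tnth y i) (tnth y j - tnth theta j / tnth theta i * tnth y i).
have mphi : measurable_fun setT phi.
  by apply: measurable_funM; [exact: measurable_expabs|exact: measurable_pow1abs].
have mpsi : measurable_fun setT (fun p : mR * mR => psi p.1 p.2).
  apply: (@measurableT_comp _ _ _ _ _ _ (@expR R)); first exact: measurable_expR.
  apply: measurable_funM; last by apply: measurableT_comp.
  apply: measurableT_comp => //; apply: measurable_funM => //.
  apply: (@eq_measurable_fun _ _ _ _ _ (fun p : mR * mR => (1 + `|p.1|) `^ (- 2^-1))).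
    by move=> p _; rewrite powRN powR12_sqrt// ltW// abs1_gt0.
  by apply: (measurableT_comp (measurable_pow1abs _)).
have phi0 a : 0 <= phi a by rewrite mulr_ge0 ?expR_ge0 ?powR_ge0.
have psi0 a t : 0 <= psi a t by exact: expR_ge0.
have sq0 (a : R) : 0 < Num.sqrt (1 + `|a|) by rewrite sqrtr_gt0 abs1_gt0.
have I2 : (\int[leb]_y (F2 y)%:E <= ((2 / c) ^+ d' * (C2 * s `^ (- rho)))%:E)%E.
  rewrite /F2 (integral_shear i (W := fun a => 2 / (c / Num.sqrt (1 + `|a|)))
     (fun j => tnth theta j / tnth theta i : R))//; last first.
    by move=> a; apply: integral_exp_abs; rewrite divr_gt0.
  rewrite (_ : (\int[mu]_a _)%E = \int[mu]_a (((2 / c) ^+ d')%:E *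
      ((1 + `|a|) `^ k * expR (- (s / 2) * `|a|))%:E))%E; last first.
    apply: eq_integral => a _; rewrite -EFinM; congr EFin.
    rewrite (_ : 2 / (c / Num.sqrt (1 + `|a|)) = 2 / c * Num.sqrt (1 + `|a|)); last first.
      by field; rewrite !gt_eqF.
    rewrite exprMn -(powR12_sqrt (ltW (abs1_gt0 a))) -(powR_mulrn d' (powR_ge0 (1 + `|a|) 2^-1)) -powRrM.
    rewrite /k (_ : d'%:R / 2 - g = - g + 2^-1 * d'%:R); last by field.
    rewrite powRD; last by rewrite (gt_eqF (abs1_gt0 a)) implybT.
    by rewrite /phi; ring.
  rewrite ge0_integralZl//; last 2 first.
  - by apply/measurable_EFinP; apply: measurable_funM;
      [exact: measurable_pow1abs|exact: measurable_expabs].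
  - by rewrite lee_fin exprn_ge0// divr_ge0// ltW.
  rewrite EFinM; apply: lee_wpmul2l; first by rewrite lee_fin exprn_ge0// divr_ge0// ltW.
  by rewrite -kE; exact: C2P.
have mF2 : measurable_fun setT (fun y => (F2 y)%:E).
  by apply/measurable_EFinP; exact: measurable_shear.
have F20 y : (0 <= (F2 y)%:E)%E by rewrite lee_fin mulr_ge0// prodr_ge0.
have dotU y : (m - s) * dot y theta <= (m - s) * enorm y.
  apply: ler_wpM2l; first by rewrite subr_ge0.
  by apply: le_trans (dot_le _ _) _; rewrite t1 mulr1.
have I1 : (\int[leb]_y (F1 y)%:E <= (C1 * m `^ rho * s `^ (- rho))%:E)%E.
  apply: (@le_trans _ _ (C1 * 1 `^ (d%:R - g))%:E).
    apply: C1P => //.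
    - by move=> y H; rewrite /F1 leNgt H mulr0.
    - move=> y y0; apply: (@le_trans _ _ (F y)).
        by rewrite ler_piMr// lern1 leq_b1.
      apply: (@le_trans _ _ (expR (- m * enorm y) * enorm y `^ (- g) * expR (m * enorm y))).
        apply: ler_pM; rewrite ?f0 ?expR_ge0 ?fE// ler_expR.
        by apply: le_trans (dotU y) _; rewrite ler_wpM2r ?enorm_ge0//; lra.
      by rewrite mulrAC -expRD mulNr addNr expR0 mul1r.
    - move=> y y0; rewrite powR1; apply: (@le_trans _ _ (F y)).
        by rewrite ler_piMr// lern1 leq_b1.
      rewrite -[leRHS]mulr1; apply: ler_pM; rewrite ?f0 ?expR_ge0 ?fz// -expR0 ler_expR.
      by apply: le_trans (dotU y) _; rewrite y0 mulr0.
  rewrite lee_fin powR1 mulr1 -mulrA ler_peMr ?(ltW C10)// powRN.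
  rewrite ler_pdivlMr ?powR_gt0// mul1r.
  by apply: ge0_ler_powR; rewrite ?nnegrE ?(ltW rho0) ?(ltW s0) ?(ltW m0).
apply: (@le_trans _ _ (\int[leb]_y ((F1 y)%:E + A%:E * (F2 y)%:E))%E).
  apply: ge0_le_integral => //.
  - by move=> y _; rewrite lee_fin; exact: F0.
  - exact/measurable_EFinP.
  - apply: emeasurable_funD; first exact/measurable_EFinP.
    exact: emeasurable_funM.
  - move=> y _; rewrite -EFinM -EFinD lee_fin -/(F y) /F1.
    have [H|H] := leP (enorm y) 1.
      by rewrite mulr1 lerDl mulr_ge0// -lee_fin.
    rewrite mulr0 add0r.
    have y0 : 0 < enorm y by lra.
    rewrite /F2 [leRHS]mulrA.
    apply: le_trans; last exact: (far_bound s0 sm g0 t1 ti (ltW H)).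
    rewrite expRD mulrAC; apply: ler_wpM2r; first exact: expR_ge0.
    exact: fE.
rewrite ge0_integralD//; last 4 first.
- by move=> y _; rewrite lee_fin.
- exact/measurable_EFinP.
- by move=> y _; apply: mule_ge0; [rewrite lee_fin|exact: F20].
- exact: emeasurable_funM.
rewrite ge0_integralZl// ?lee_fin// mulrDl EFinD; apply: leeD => //.
rewrite (_ : _ * _ * _ * _ = A * ((2 / c) ^+ d' * (C2 * s `^ (- rho)))); last by rewrite /rho; ring.
rewrite [X in (_ <= X)%E]EFinM; apply: lee_wpmul2l; first by rewrite lee_fin.
exact: I2.
Qed.
End TiltedMass.

(** * From convolution powers to the Poisson series *)

Section SeriesUpper.
Context {R : realType}.

Lemma exp_partial_le (x : R) n : 0 <= x ->
  \sum_(0 <= k < n) x ^+ k / k`!%:R <= expR x.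
Proof.
move=> x0.
have := @nondecreasing_cvgn_le R (series (exp_coeff x)) _ (is_cvg_series_exp_coeff x) n.
apply; apply/nondecreasing_series => k _ _; exact: exp_coeff_ge0.
Qed.

(** The sum starts at 1 and the bound b is indexed from 0. *)
Lemma eseries1_le_bound (a : nat -> \bar R) (b : nat -> R) (B : R) :
  (forall k, 0 <= a k.+1)%E -> (forall k, a k.+1 <= (b k)%:E)%E ->
  (forall n, \sum_(0 <= k < n) b k <= B) ->
  (\sum_(1 <= k <oo) a k <= B%:E)%E.
Proof.
move=> a0 ab bB.
have b0 k : 0 <= b k by rewrite -lee_fin; apply: le_trans (ab k).
have B0 : 0 <= B by apply: le_trans (bB 0%N); rewrite big_nil.
apply: lime_le.
  by apply: is_cvg_nneseries => -[|k].
apply: nearW => -[|n]; first by rewrite big_geq// lee_fin.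
rewrite big_add1 /=; apply: (@le_trans _ _ (\sum_(0 <= k < n) (b k)%:E)%E).
  by apply: lee_sum.
by rewrite sumEFin lee_fin.
Qed.

Lemma natpow_le_geometric (g beta : R) : 0 <= g -> 1 < beta ->
  exists2 K : R, 0 < K & forall n, n.+1%:R `^ g <= K * beta ^+ n.
Proof.
move=> g0 b1; have b0 : 0 < beta by lra.
have [K K0 KP] := powR_le_expR g0 (ln_gt0 b1).
exists (K * beta); first exact: mulr_gt0.
move=> n; apply: le_trans (KP _ (ler0n _ _)) _.
by rewrite expRM_natr lnK ?posrE// exprS mulrA.
Qed.

Definition poisson_series {d : nat} (f : Rn R d -> R) (lambda : R) x : \bar R :=
  (\sum_(1 <= n <oo) ((lambda ^+ n / n`!%:R)%:E * conv_pow f n x))%E.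

(** After undoing the tilt, the term of index n + 1 is, up to factors independent of
    n, at most (n + 1)^g (lambda L)^n / n!; the power (n + 1)^g is absorbed by beta^n. *)
Lemma poisson_series_upper (g beta : R) : 0 <= g -> 1 < beta ->
  exists2 K : R, 0 < K &
  forall (d : nat) (f : Rn R d -> R) (k : R) (theta x : Rn R d) (L lambda : R),
    measurable_fun setT f -> (forall u, 0 <= f u) ->
    (forall u, 0 < enorm u -> f u * expR (k * dot u theta) <= enorm u `^ (- g)) ->
    (\int[lebesgue_Rn d]_u (f u * expR (k * dot u theta))%:E = L%:E)%E ->
    0 < lambda -> 0 < enorm x ->
    (poisson_series f lambda x <=
     (K * lambda * enorm x `^ (- g) * expR (- k * dot x theta) *
      expR (beta * lambda * L))%:E)%E.
Proof.
move=> g0 b1; have b0 : 0 < beta by lra.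
have [K K0 KP] := natpow_le_geometric g0 b1.
exists K => // d f k theta x L lambda mf f0 fg fL l0 x0.
pose G u := f u * expR (k * dot u theta).
have mG : measurable_fun setT G.
  apply: measurable_funM => //.
  apply: (@measurableT_comp _ _ _ _ _ _ (@expR R)); first exact: measurable_expR.
  by apply: measurable_funM => //; exact: measurable_dot.
have G0 u : 0 <= G u by rewrite mulr_ge0 ?expR_ge0.
have L0 : 0 <= L by rewrite -lee_fin -fL; apply: integral_ge0 => u _; rewrite lee_fin; exact: G0.
set E := expR (- k * dot x theta).
have fE n : conv_pow f n.+1 x = (E%:E * conv_pow G n.+1 x)%E.
  rewrite (conv_pow_tilt k theta n x mf f0) muleA -EFinM /E -expRD mulNr addNr.
  by rewrite expR0 mul1e.
have B0 s : 0 < s -> 0 <= s `^ (- g) by rewrite powR_ge0.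
have GB s u : 0 < s -> s <= enorm u -> G u <= s `^ (- g).
  move=> s0 su; apply: le_trans (fg u (lt_le_trans s0 su)) _.
  exact: powRN_anti.
have E0 : 0 <= E by exact: expR_ge0.
pose c := K * lambda * enorm x `^ (- g) * E.
have c0 : 0 <= c by rewrite /c !mulr_ge0 ?powR_ge0 ?expR_ge0 ?(ltW K0) ?(ltW l0).
rewrite /poisson_series.
apply: (@eseries1_le_bound _ (fun n => c * ((beta * lambda * L) ^+ n / n`!%:R))).
- move=> n; rewrite mule_ge0 ?conv_pow_ge0// lee_fin divr_ge0// exprn_ge0//.
  exact: ltW.
- move=> n; rewrite fE muleA -EFinM.
  have h := conv_pow_le mG G0 fL B0 GB n x0 (lexx (enorm x)).
  apply: le_trans (lee_wpmul2l _ h) _.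
    by rewrite lee_fin mulr_ge0 ?expR_ge0// divr_ge0// exprn_ge0// ltW.
  rewrite -EFinM lee_fin.
  have n1 : 0 <= n.+1%:R^-1 :> R by rewrite invr_ge0.
  rewrite powRM ?(ltW x0)// (_ : n.+1%:R^-1 `^ (- g) = n.+1%:R `^ g); last first.
    by rewrite -powR_inv1// -powRrM mulN1r opprK.
  rewrite factS natrM exprS.
  have nz : n.+1%:R != 0 :> R by rewrite pnatr_eq0.
  have fz : n`!%:R != 0 :> R by rewrite pnatr_eq0 -lt0n fact_gt0.
  rewrite [leLHS](_ : _ = (lambda * enorm x `^ (- g) * E * (lambda ^+ n * L ^+ n / n`!%:R))
      * n.+1%:R `^ g); last first.
    by field; rewrite fz nat1r nz.
  rewrite [leRHS](_ : _ = (lambda * enorm x `^ (- g) * E * (lambda ^+ n * L ^+ n / n`!%:R))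
      * (K * beta ^+ n)); last by rewrite /c !exprMn; ring.
  apply: ler_wpM2l; last exact: KP.
  by rewrite !mulr_ge0 ?powR_ge0 ?expR_ge0 ?exprn_ge0 ?invr_ge0 ?(ltW l0).
- move=> n; rewrite -mulr_sumr; apply: ler_wpM2l => //.
  by apply: exp_partial_le; rewrite !mulr_ge0 ?(ltW b0) ?(ltW l0).
Qed.

Lemma L1normE (d : nat) (f : Rn R d -> R) (L : R) : (forall u, 0 <= f u) ->
  (\int[lebesgue_Rn d]_u (f u)%:E = L%:E)%E -> L1norm f = L.
Proof.
move=> f0 fL; rewrite /L1norm Lnorm1.
rewrite (_ : (\int[_]_x _)%E = L%:E)//.
by rewrite -fL; apply: eq_integral => u _ /=; rewrite ger0_norm.
Qed.
End SeriesUpper.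

(** * Upper estimates *)

Section UpperBounds.
Context {R : realType} {d' : nat}.
Local Notation d := d'.+1.
Local Notation leb := (@lebesgue_Rn R d).
Implicit Types x y u theta : Rn R d.

Variables (m g : R) (f : Rn R d -> R).
Hypotheses (m0 : 0 < m) (g0 : 0 <= g) (gd : g < (d%:R + 1) / 2).
Hypotheses (mf : measurable_fun setT f) (f0 : forall u, 0 <= f u).
Hypothesis fE : forall u, 0 < enorm u ->
  f u <= expR (- m * enorm u) * enorm u `^ (- g).
Hypothesis fz : forall u, enorm u = 0 -> f u <= 1.
Local Notation rho := ((d%:R + 1) / 2 - g).

Let rho0 : 0 < rho. Proof. by rewrite subr_gt0. Qed.

(** The mass of the tilted profile as a real number, which is the form in which the
    bounds on convolution powers take it. *)
Lemma mass_finite (k : R) theta (B : R) :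
  (\int[leb]_u (f u * expR (k * dot u theta))%:E <= B%:E)%E ->
  exists2 L, (\int[leb]_u (f u * expR (k * dot u theta))%:E = L%:E)%E & L <= B.
Proof.
set I := (\int[leb]_u _)%E => IB.
have I0 : (0 <= I)%E by apply: integral_ge0 => u _; rewrite lee_fin mulr_ge0 ?expR_ge0.
have If : I \is a fin_num by rewrite ge0_fin_numE// (le_lt_trans IB) ?ltry.
by exists (fine I); rewrite ?fineK// -lee_fin fineK.
Qed.

Lemma tilt_decay (k : R) theta u : 0 <= k -> k <= m -> enorm theta = 1 ->
  0 < enorm u -> f u * expR (k * dot u theta) <= enorm u `^ (- g).
Proof.
move=> k0 km t1 u0.
apply: (@le_trans _ _ (expR (- m * enorm u) * enorm u `^ (- g) * expR (m * enorm u))).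
  apply: ler_pM; rewrite ?f0 ?expR_ge0 ?fE// ler_expR.
  apply: (@le_trans _ _ (k * enorm u)).
    by apply: ler_wpM2l => //; have := dot_le u theta; rewrite t1 mulr1.
  by rewrite ler_wpM2r// ltW.
by rewrite mulrAC -expRD mulNr addNr expR0 mul1r.
Qed.

Lemma poisson_series_tilted : exists K C : R, [/\ 0 < K, 0 < C &
  forall x s lambda, 1 <= enorm x -> 0 < s -> s <= m -> 0 < lambda ->
  (poisson_series f lambda x <= (K * lambda * enorm x `^ (- g) *
     expR (- m * enorm x + (s * enorm x + C * (lambda * s `^ (- rho)))))%:E)%E].
Proof.
have [C C0 CP] := tilted_mass m0 g0 gd.
have [K K0 KP] := @poisson_series_upper R g 2 g0 ltac:(lra).
exists K, (2 * C); split; rewrite ?mulr_gt0//.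
move=> x s lambda x1 s0 sm l0.
have x0 : 0 < enorm x by lra.
have [theta t1 xt] := direction x0.
have [L LE LC] := mass_finite (CP f theta s mf f0 fE fz t1 s0 sm).
have ms0 : 0 <= m - s by rewrite subr_ge0.
have msm : m - s <= m by lra.
apply: le_trans (KP d f (m - s) theta x L lambda mf f0 _ LE l0 x0) _.
  by move=> u; exact: tilt_decay.
rewrite lee_fin -mulrA; apply: ler_wpM2l.
  by rewrite !mulr_ge0 ?powR_ge0 ?(ltW K0) ?(ltW l0).
rewrite -expRD ler_expR (dot_direction t1 xt).
have : lambda * L <= lambda * (C * s `^ (- rho)) by rewrite ler_pM2l.
move: (s `^ _) => S; nra.
Qed.

(** The scale s = m / |x| keeps both s |x| and lambda s^(-rho) bounded. *)
Lemma poisson_series_upper_small : exists2 E : R, 0 < E &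
  forall x lambda, 1 <= enorm x -> 0 < lambda -> lambda * enorm x `^ rho <= 1 ->
  (poisson_series f lambda x <=
    (E * (lambda * expR (- m * enorm x) * enorm x `^ (- g)))%:E)%E.
Proof.
have [K [C [K0 C0 KP]]] := poisson_series_tilted.
exists (K * expR (m + C * m `^ (- rho))); first by rewrite mulr_gt0 ?expR_gt0.
move=> x lambda x1 l0 z1; have x0 : 0 < enorm x by lra.
have s0 : 0 < m / enorm x by rewrite divr_gt0.
have sm : m / enorm x <= m by rewrite ler_pdivrMr// ler_peMr// ltW.
apply: le_trans (KP x _ lambda x1 s0 sm l0) _; rewrite lee_fin.
rewrite divfK ?gt_eqF// (expRD (- m * enorm x)).
rewrite [leLHS](_ : _ = K * (lambda * expR (- m * enorm x) * enorm x `^ (- g)) *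
  expR (m + C * (lambda * (m / enorm x) `^ (- rho)))); last by ring.
rewrite [leRHS]mulrAC; apply: ler_wpM2l.
  by rewrite !mulr_ge0 ?powR_ge0 ?expR_ge0 ?(ltW K0) ?(ltW l0).
rewrite ler_expR lerD2l; apply: ler_wpM2l; first exact: ltW.
rewrite powRM ?invr_ge0 ?(ltW m0) ?(ltW x0)//.
rewrite -[(enorm x)^-1](powR_inv1 (ltW x0)) -powRrM mulN1r opprK mulrCA.
by rewrite ler_piMr ?powR_ge0.
Qed.

(** The factor a > 1 leaves a surplus exp ((a - 1) lambda L), of which
    eta = (a - 1) L / 3 is one third.  The threshold eps separates the two regimes:
    below it the scale s is at most m and no surplus is needed; above it
    |x| < eps lambda, and one third of the surplus pays for exp (m |x|) and the
    power of |x|, one third for the factor lambda, and one third for beta > 1. *)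
Lemma poisson_series_upper_large (L a : R) :
  (\int[leb]_u (f u)%:E = L%:E)%E -> 0 < L -> 1 < a ->
  exists E5 E6 : R, [/\ 0 < E5, 0 < E6 &
  forall x lambda, 1 <= enorm x -> 0 < lambda -> 1 <= lambda * enorm x `^ rho ->
  (poisson_series f lambda x <=
    (E5 * expR (lambda * (a * L)) * expR (E6 * (lambda * enorm x `^ rho) `^ (1 / (rho + 1)))
     * (expR (- m * enorm x) * enorm x `^ (- ((d%:R + 1) / 2))))%:E)%E].
Proof.
move=> fL L0 a1.
have [K [C [K0 C0 KP]]] := poisson_series_tilted.
pose eta : R := (a - 1) * L / 3.
have eta0 : 0 < eta by rewrite /eta divr_gt0// mulr_gt0// subr_gt0.
pose eps : R := eta / (m + rho).
have mr0 : 0 < m + rho by rewrite addr_gt0.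
have eps0 : 0 < eps by rewrite divr_gt0.
have epsE : eps * (m + rho) = eta by rewrite /eps divfK// gt_eqF.
clearbody eps.
have etaE : 3 * eta = (a - 1) * L by rewrite /eta mulrC divfK.
clearbody eta.
pose beta : R := 1 + (a - 1) / 3.
have b1 : 1 < beta by rewrite /beta; lra.
have betaE : 3 * beta = 3 + (a - 1) by rewrite /beta; field.
clearbody beta.
have [Kb Kb0 KbP] := @poisson_series_upper R g beta g0 b1.
pose p : R := 1 / (rho + 1).
have r10 : 0 < rho + 1 by rewrite addr_gt0.
have p0 : 0 < p by rewrite divr_gt0.
have rp : (rho + 1) * p = 1 by rewrite /p mul1r divff// gt_eqF.
rewrite -/p; clearbody p.
have [K' K'0 K'P] := @powR_le_expR R (rho + 1) 1 (ltW r10) ltr01.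
pose E6 : R := 1 + m * eps `^ p + C * (m `^ (- rho) * eps `^ (- rho * p)).
have E60 : 0 < E6.
  by rewrite /E6 -addrA ltr_wpDr// addr_ge0// !mulr_ge0 ?powR_ge0 ?(ltW m0) ?(ltW C0).
have E6E t : E6 * t = t + (m * eps `^ p * t + C * (m `^ (- rho) * eps `^ (- rho * p) * t)).
  by rewrite /E6 !mulrDl mul1r -!mulrA addrA.
clearbody E6.
exists (K * K' + Kb / eta), E6; split => //.
  by apply: addr_gt0; [exact: mulr_gt0|exact: divr_gt0].
move=> x lambda x1 l0 z1; have x0 : 0 < enorm x by lra.
set r := enorm x in x1 x0 z1 *; set z := lambda * r `^ rho in z1 *.
have zdef : z = lambda * r `^ rho by [].
clearbody z.
have z0 : 0 < z by lra.
have zE : lambda * r `^ (- g) = z * r `^ (- ((d%:R + 1) / 2)).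
  rewrite zdef -mulrA -powRD; last by rewrite (gt_eqF x0) implybT.
  by congr (_ * _ `^ _); ring.
pose T := expR (- m * r) * r `^ (- ((d%:R + 1) / 2)).
have T0 : 0 < T by rewrite mulr_gt0 ?expR_gt0 ?powR_gt0.
rewrite -/T; have TE : T = expR (- m * r) * r `^ (- ((d%:R + 1) / 2)) by [].
clearbody T.
have [lr|rl] := leP (eps * lambda) r.
  pose y := (eps * lambda / r) `^ p.
  have el0 : 0 < eps * lambda by rewrite mulr_gt0.
  have elr0 : 0 < eps * lambda / r by rewrite divr_gt0.
  have s0 : 0 < m * y by rewrite mulr_gt0// powR_gt0.
  have sm : m * y <= m.
    rewrite ler_piMr ?(ltW m0)//.
    apply: (@le_trans _ _ (1 `^ p)); last by rewrite powR1.
    apply: ge0_ler_powR; rewrite ?nnegrE ?(ltW p0) ?(ltW elr0)//.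
    by rewrite ler_pdivrMr// mul1r.
  apply: le_trans (KP x _ lambda x1 s0 sm l0) _; rewrite lee_fin -/r.
  (* With p = 1 / (rho + 1), y is chosen so that s |x| and lambda s^(-rho), for
     s = m y, are both multiples of z^p. *)
  have sr : m * y * r = m * eps `^ p * z `^ p.
    rewrite -!mulrA; congr (_ * _); rewrite -powRM ?(ltW eps0) ?(ltW z0)//.
    have rE : r = (r `^ (rho + 1)) `^ p by rewrite -powRrM rp powRr1// ltW.
    rewrite {1}rE /y -powRM ?(ltW elr0) ?powR_ge0//; congr (_ `^ _).
    rewrite powRD; last by rewrite (gt_eqF x0) implybT.
    by rewrite powRr1 ?(ltW x0)// zdef; field; rewrite gt_eqF.
  have ls : lambda * (m * y) `^ (- rho) = m `^ (- rho) * eps `^ (- rho * p) * z `^ p.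
    rewrite powRM ?(ltW m0) ?powR_ge0// mulrCA -mulrA; congr (_ * _).
    have lE : lambda = (lambda `^ (rho + 1)) `^ p by rewrite -powRrM rp powRr1// ltW.
    rewrite {1}lE /y (powRAC _ p (- rho)) -powRM ?powR_ge0// (powRrM eps) -powRM ?powR_ge0 ?(ltW z0)//.
    congr (_ `^ _); rewrite (_ : eps * lambda / r = eps * (lambda * r^-1)); last by rewrite mulrA.
    rewrite powRM ?(ltW eps0) ?mulr_ge0 ?invr_ge0 ?(ltW l0) ?(ltW x0)//.
    rewrite powRM ?invr_ge0 ?(ltW l0) ?(ltW x0)//.
    rewrite -[r^-1](powR_inv1 (ltW x0)) -powRrM mulN1r opprK.
    rewrite powRD; last by rewrite (gt_eqF l0) implybT.
    rewrite (powRr1 (ltW l0)) !powRN zdef; field.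
    by rewrite !gt_eqF ?powR_gt0.
  rewrite sr ls expRD.
  rewrite (_ : K * lambda * r `^ (- g) * _ = K * z * (T *
     expR (m * eps `^ p * z `^ p + C * (m `^ (- rho) * eps `^ (- rho * p) * z `^ p)))); last first.
    by rewrite -(mulrA K) zE TE; move: (expR (_ + _)) => X; ring.
  have zle : z <= K' * expR (z `^ p).
    have := K'P (z `^ p) (powR_ge0 _ _).
    by rewrite -powRrM mulrC rp powRr1 ?(ltW z0)// mul1r mulrC.
  apply: (@le_trans _ _ (K * (K' * expR (z `^ p)) * (T *
     expR (m * eps `^ p * z `^ p + C * (m `^ (- rho) * eps `^ (- rho * p) * z `^ p))))).
    apply: ler_wpM2r; first by rewrite mulr_ge0 ?expR_ge0// ltW.
    by rewrite ler_pM2l.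
  rewrite [leLHS](_ : _ = K * K' * expR (E6 * z `^ p) * T); last first.
    by rewrite E6E (expRD (z `^ p)); move: (expR _) (expR _) => X Y; ring.
  apply: ler_wpM2r; first exact: ltW.
  apply: ler_wpM2r; first exact: expR_ge0.
  apply: (@le_trans _ _ (K * K' + Kb / eta)).
    by rewrite lerDl divr_ge0// ltW.
  rewrite ler_peMr//; first by rewrite addr_ge0 ?divr_ge0 ?mulr_ge0 ?(ltW K0) ?(ltW K'0) ?(ltW Kb0) ?(ltW eta0).
  by rewrite -expR0 ler_expR !mulr_ge0 ?(ltW l0) ?(ltW L0)//; lra.
have [theta t1 xt] := direction x0.
have fL0 : (\int[leb]_u (f u * expR (0 * dot u theta))%:E = L%:E)%E.
  by rewrite -fL; apply: eq_integral => u _; rewrite mul0r expR0 mulr1.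
apply: le_trans (KbP d f 0 theta x L lambda mf f0 _ fL0 l0 x0) _.
  by move=> u; apply: tilt_decay => //; exact: ltW.
rewrite lee_fin -/r oppr0 mul0r expR0 mulr1 -(mulrA Kb) zE.
(* The remaining regime is |x| < eps lambda. *)
have powexp (t : R) : 0 <= t -> r `^ t <= expR (t * r).
  move=> t0; rewrite mulrC expRM; apply: ge0_ler_powR; rewrite ?nnegrE ?expR_ge0 ?(ltW x0)//.
  by apply: le_trans (expR_ge1Dx _); rewrite lerDr.
have h1 : lambda <= eta^-1 * expR (eta * lambda).
  rewrite ler_pdivlMl//; apply: le_trans (expR_ge1Dx _); by rewrite lerDr.
have h2 : r `^ rho <= expR (eta * lambda) * expR (- m * r).
  apply: le_trans (powexp _ (ltW rho0)) _; rewrite -expRD ler_expR.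
  have : r * (m + rho) <= eps * lambda * (m + rho) by rewrite ler_pM2r// ltW.
  by rewrite mulrAC epsE; move: rho => q; nra.
rewrite TE [leRHS](_ : _ = (K * K' + Kb / eta) * (expR (lambda * (a * L)) *
  expR (E6 * z `^ p)) * expR (- m * r) * r `^ (- ((d%:R + 1) / 2))); last by ring.
rewrite [leLHS](_ : _ = Kb * z * expR (beta * lambda * L) *
  r `^ (- ((d%:R + 1) / 2))); last by ring.
apply: ler_wpM2r; first exact: powR_ge0.
have h3 : z <= eta^-1 * expR (eta * lambda) * (expR (eta * lambda) * expR (- m * r)).
  by rewrite zdef; apply: ler_pM; rewrite ?powR_ge0 ?(ltW l0).
apply: (@le_trans _ _ (Kb * (eta^-1 * expR (eta * lambda) *
   (expR (eta * lambda) * expR (- m * r))) * expR (beta * lambda * L))).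
  by apply: ler_wpM2r; [exact: expR_ge0|rewrite ler_pM2l].
rewrite [leLHS](_ : _ = Kb / eta * (expR (eta * lambda) * expR (eta * lambda)
  * expR (beta * lambda * L)) * expR (- m * r)); last by ring.
apply: ler_wpM2r; first exact: expR_ge0.
rewrite -!expRD (_ : eta * lambda + _ + _ = lambda * (a * L)); last first.
  have : 3 * (eta * lambda + eta * lambda + beta * lambda * L) =
    2 * lambda * (3 * eta) + lambda * L * (3 * beta) by ring.
  rewrite etaE betaE; lra.
apply: ler_pM; rewrite ?divr_ge0 ?expR_ge0 ?(ltW Kb0) ?(ltW eta0)//.
  by rewrite lerDr mulr_ge0// ltW.
by rewrite ler_expR lerDl mulr_ge0 ?powR_ge0// ltW.
Qed.
End UpperBounds.

(** * Lower estimates *)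

Section LowerBound.
Context {R : realType} {d' : nat}.
Local Notation d := d'.+1.
Implicit Types x y u theta : Rn R d.

Lemma poisson_series_ge_term (f : Rn R d -> R) lambda x n :
  (forall u, 0 <= f u) -> 0 <= lambda ->
  ((lambda ^+ n.+1 / n.+1`!%:R)%:E * conv_pow f n.+1 x <= poisson_series f lambda x)%E.
Proof.
move=> f0 l0.
have t0 k : (0 <= (lambda ^+ k.+1 / k.+1`!%:R)%:E * conv_pow f k.+1 x)%E.
  by rewrite mule_ge0 ?conv_pow_ge0// lee_fin divr_ge0// exprn_ge0.
have h := @nneseries_lim_ge R (fun k => (lambda ^+ k / k`!%:R)%:E * conv_pow f k x)%E
  xpredT 1 n.+2.
apply: le_trans (h _); last by case.
rewrite big_nat_recr//= leeDr// big_add1 /=; apply: sume_ge0 => k _; exact: t0.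
Qed.

Variables (m g rho1 : R) (f : Rn R d -> R) (G : R -> R).
Hypotheses (m0 : 0 < m) (g0 : 0 <= g) (gd : g < (d%:R + 1) / 2).
Hypotheses (mf : measurable_fun setT f) (f0 : forall u, 0 <= f u).
Local Notation rho := ((d%:R + 1) / 2 - g).
Hypothesis rho1P : rho <= rho1.
Hypothesis fG : forall tau u, 0 < tau -> tau / 2 <= enorm u -> enorm u <= 2 * tau ->
  2 `^ (- g) * G tau * expR (- m * enorm u) <= f u.
Hypothesis G1 : forall tau, 1 <= tau -> G tau = tau `^ (- g).
Hypothesis G0 : forall tau, 0 < tau -> tau <= 1 -> G tau = tau `^ (rho1 - d%:R).
Hypothesis fE : forall u, 1 <= enorm u ->
  f u = expR (- m * enorm u) * enorm u `^ (- g).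

Let kappa : R := 2 `^ (- g) * expR (- m) / (10 * d%:R) / (5 * d%:R) ^+ d'.
Let Q (tau : R) : R := 2 `^ (- g) * G tau * expR (- m) * @tube_volume R d' tau.

Let D0 : 0 < d%:R :> R. Proof. by rewrite ltr0n. Qed.
Let D1 : 1 <= d%:R :> R. Proof. by rewrite ler1n. Qed.

Lemma kappa_gt0 : 0 < kappa.
Proof. by rewrite /kappa !divr_gt0 ?mulr_gt0 ?expR_gt0 ?powR_gt0 ?exprn_gt0 ?mulr_gt0. Qed.

Let dE : d%:R = d'%:R + 1 :> R. Proof. by rewrite natr1. Qed.

Lemma tube_volume_ge1 tau : 1 <= tau ->
  @tube_volume R d' tau = tau `^ ((d%:R + 1) / 2) / (10 * d%:R) / (5 * d%:R) ^+ d'.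
Proof.
move=> t1; have t0 : 0 < tau by lra.
have s1 : 1 <= Num.sqrt tau by rewrite -(sqrtr1 R) ler_sqrt// ltW.
have st : Num.sqrt tau <= tau.
  by rewrite -{2}(sqr_sqrtr (ltW t0)) expr2 ler_peMl ?sqrtr_ge0.
rewrite /tube_volume (min_idPr st) expr_div_n -powR12_sqrt ?(ltW t0)//.
rewrite -powR_mulrn ?powR_ge0// -powRrM.
rewrite (_ : (d%:R + 1) / 2 = 1 + 2^-1 * d'%:R); last by rewrite dE; field.
rewrite powRD; last by rewrite (gt_eqF t0) implybT.
by rewrite (powRr1 (ltW t0)); ring.
Qed.

Lemma tube_volume_le1 tau : 0 < tau -> tau <= 1 ->
  @tube_volume R d' tau = tau `^ d%:R / (10 * d%:R) / (5 * d%:R) ^+ d'.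
Proof.
move=> t0 t1.
have s1 : Num.sqrt tau <= 1 by rewrite -(sqrtr1 R) ler_sqrt.
have st : tau <= Num.sqrt tau.
  by rewrite -{1}(sqr_sqrtr (ltW t0)) expr2 ler_piMl ?sqrtr_ge0.
rewrite /tube_volume (min_idPl st) expr_div_n powR_mulrn ?(ltW t0)// exprS.
ring.
Qed.

Lemma Q_ge1 tau : 1 <= tau -> Q tau = kappa * tau `^ rho.
Proof.
move=> t1; have t0 : 0 < tau by lra.
rewrite /Q tube_volume_ge1// G1//.
rewrite (_ : rho = - g + (d%:R + 1) / 2); last by ring.
rewrite powRD; last by rewrite (gt_eqF t0) implybT.
rewrite /kappa; ring.
Qed.

Lemma Q_le1 tau : 0 < tau -> tau <= 1 -> Q tau = kappa * tau `^ rho1.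
Proof.
move=> t0 t1; rewrite /Q tube_volume_le1// G0//.
rewrite (_ : tau `^ rho1 = tau `^ (rho1 - d%:R) * tau `^ d%:R); last first.
  by rewrite -powRD ?subrK// (gt_eqF t0) implybT.
rewrite /kappa; ring.
Qed.

(** The convolution power of order n + 1 has n tubes but n + 1 factors of the
    profile; this bounds the missing tube. *)
Lemma tube_volume_le_pow tau r : 0 < tau -> tau <= r -> 1 <= r ->
  @tube_volume R d' tau <= r `^ ((d%:R + 1) / 2).
Proof.
move=> t0 tr r1.
have e0 : 0 <= (d%:R + 1) / 2 :> R by rewrite divr_ge0// addr_ge0.
have c1 (V : R) : 0 <= V -> V / (10 * d%:R) / (5 * d%:R) ^+ d' <= V.
  move=> V0; rewrite -mulrA ler_piMr// -invfM invf_le1.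
    have D10 : 1 <= 10 * d%:R :> R by move: D1; lra.
    have D5 : 1 <= 5 * d%:R :> R by move: D1; lra.
    by rewrite mulr_ege1// exprn_ege1.
  by rewrite mulr_gt0 ?exprn_gt0 ?mulr_gt0.
have [t1|/ltW t1] := leP 1 tau.
  rewrite tube_volume_ge1//; apply: le_trans (c1 _ (powR_ge0 _ _)) _.
  by apply: ge0_ler_powR; rewrite ?nnegrE ?(ltW t0)//; lra.
rewrite tube_volume_le1//; apply: le_trans (c1 _ (powR_ge0 _ _)) _.
apply: (@le_trans _ _ 1).
  rewrite powR_mulrn ?(ltW t0)//; apply: exprn_ile1 => //; exact: ltW.
by apply: (@le_trans _ _ (r `^ 0)); [rewrite powRr0|exact: ler_powR].
Qed.

Lemma tube_volume_gt0 tau : 0 < tau -> 0 < @tube_volume R d' tau.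
Proof.
move=> t0; rewrite /tube_volume mulr_gt0 ?divr_gt0 ?mulr_gt0//.
by rewrite exprn_gt0// divr_gt0 ?mulr_gt0// lt_min t0 sqrtr_gt0.
Qed.

Lemma G_ge0 tau : 0 < tau -> 0 <= G tau.
Proof.
move=> t0; have [t1|/ltW t1] := leP 1 tau; first by rewrite G1// powR_ge0.
by rewrite G0// powR_ge0.
Qed.

Let Q_ge0 tau : 0 < tau -> 0 <= Q tau.
Proof.
move=> t0; apply: mulr_ge0; last exact/ltW/tube_volume_gt0.
by rewrite !mulr_ge0 ?powR_ge0 ?expR_ge0 ?G_ge0.
Qed.

Lemma conv_pow_lower n x : 1 <= enorm x ->
  ((Q (enorm x / n.+1%:R) ^+ n.+1 *
    (expR (- m * enorm x) * enorm x `^ (- ((d%:R + 1) / 2))))%:E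
   <= conv_pow f n.+1 x)%E.
Proof.
move=> x1; have x0 : 0 < enorm x by lra.
set r := enorm x in x1 x0 *; set tau := r / n.+1%:R.
have tau0 : 0 < tau by rewrite divr_gt0.
have taur : n.+1%:R * tau = r by rewrite /tau mulrC divfK.
have taule : tau <= r by rewrite /tau ler_pdivrMr// ler_peMr ?ler1n// ltW.
pose K := 2 `^ (- g) * G tau.
have K0 : 0 <= K by rewrite mulr_ge0 ?powR_ge0 ?G_ge0.
apply: le_trans (@conv_pow_chain R d' f m K tau mf f0 (ltW m0) K0 tau0 _ n x _ _); last first.
- by rewrite -/r -taur ler_pM2r// ler_nat.
- by rewrite -/r taur.
- by move=> u; exact: fG.
have V0 := tube_volume_gt0 tau0.
have Vle := tube_volume_le_pow tau0 taule x1.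
rewrite lee_fin -/r exprS mulrA -/(Q tau) -/r.
have Q0 := Q_ge0 tau0.
rewrite [leLHS](_ : _ = Q tau ^+ n * expR (- m * r) * (Q tau * r `^ (- ((d%:R + 1) / 2)))); last by ring.
rewrite [leRHS](_ : _ = Q tau ^+ n * expR (- m * r) * K); last by rewrite -/(Q tau); ring.
apply: ler_wpM2l; first by rewrite mulr_ge0 ?exprn_ge0 ?expR_ge0.
rewrite powRN ler_pdivrMr ?powR_gt0// /Q -/K -mulrA; apply: ler_wpM2l => //.
by apply: le_trans Vle; apply: ler_piMl; [exact: ltW|rewrite expR_le1 oppr_le0 ltW].
Qed.

Lemma fact_le_expn n : (n`! <= n ^ n)%N.
Proof.
elim: n => // n IH; rewrite factS expnS leq_mul2l /=.
by apply: leq_trans IH _; case: n => // n; rewrite leq_exp2r.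
Qed.

(** Choose n + 1 as the integer part of (c z)^(1 / (rho1 + 1)), where
    c = kappa / e.  Then (lambda / (n + 1)) Q(|x| / (n + 1)) >= e in both regimes of
    Q, so the term of index n + 1 is at least e^(n + 1).  If that integer part is 0,
    the exponential is bounded and the first term of the series suffices. *)
Lemma poisson_series_lower : exists2 E : R, 0 < E &
  forall x lambda, 1 <= enorm x -> 0 < lambda -> 1 <= lambda * enorm x `^ rho ->
  ((expR (-1) * expR (E * (lambda * enorm x `^ rho) `^ (1 / (rho1 + 1))) *
    (expR (- m * enorm x) * enorm x `^ (- ((d%:R + 1) / 2))))%:E
   <= poisson_series f lambda x)%E.
Proof.
have rho0 : 0 < rho by rewrite subr_gt0.
have r10 : 0 < rho1 + 1 by apply: addr_gt0 => //; exact: lt_le_trans rho1P.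
pose c := kappa * expR (-1).
have c0 : 0 < c by rewrite mulr_gt0 ?kappa_gt0 ?expR_gt0.
pose p : R := 1 / (rho1 + 1).
have p0 : 0 < p by rewrite divr_gt0.
have rp : p * (rho1 + 1) = 1 by rewrite /p mul1r mulVf// gt_eqF.
exists (c `^ p); first exact: powR_gt0.
rewrite -/p; clearbody p.
move=> x lambda x1 l0 z1; have x0 : 0 < enorm x by lra.
set T := expR (- m * enorm x) * _.
have T0 : 0 <= T by rewrite mulr_ge0 ?expR_ge0 ?powR_ge0.
set z := lambda * enorm x `^ rho in z1 *.
have z0 : 0 < z by lra.
rewrite -powRM ?(ltW c0) ?(ltW z0)//.
have w0 : 0 <= (c * z) `^ p by exact: powR_ge0.
have [w1|w1] := ltP ((c * z) `^ p) 1.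
  apply: le_trans (poisson_series_ge_term x 0 f0 (ltW l0)).
  rewrite /conv_pow /= divr1 expr1 fE//.
  rewrite -EFinM lee_fin.
  rewrite (_ : lambda * _ = z * T); last first.
    have gE : enorm x `^ (- g) = enorm x `^ rho * enorm x `^ (- ((d%:R + 1) / 2)).
      by rewrite -powRD ?(gt_eqF x0) ?implybT//; congr (_ `^ _); ring.
    by rewrite /z /T gE; ring.
  apply: ler_wpM2r => //; apply: le_trans z1.
  by rewrite -expRD expR_le1; lra.
have [n [n1 n2]] : exists n, n.+1%:R <= (c * z) `^ p /\ (c * z) `^ p <= n.+2%:R.
  have /andP[t1 t2] := truncn_itv w0.
  have : (0 < Num.truncn ((c * z) `^ p))%N by rewrite truncn_gt0.
  case: (Num.truncn _) t1 t2 => // n t1 t2 _.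
  by exists n; split => //; exact: ltW.
apply: le_trans (poisson_series_ge_term x n f0 (ltW l0)).
have n0 : 0 < n.+1%:R :> R by rewrite ltr0n.
have npow : n.+1%:R `^ (rho1 + 1) <= c * z.
  have cz : c * z = ((c * z) `^ p) `^ (rho1 + 1).
    by rewrite -powRrM rp powRr1// mulr_ge0// ltW.
  rewrite [leRHS]cz.
  by apply: ge0_ler_powR; rewrite ?nnegrE ?(ltW r10)// ltW.
have tau0 : 0 < enorm x / n.+1%:R by rewrite divr_gt0.
have key : expR 1 <= lambda * Q (enorm x / n.+1%:R) / n.+1%:R.
  have h : expR 1 * n.+1%:R `^ (rho1 + 1) <= kappa * z.
    rewrite (_ : kappa * z = expR 1 * (c * z)); first by rewrite ler_pM2l ?expR_gt0.
    rewrite (_ : expR 1 * (c * z) = kappa * z * (expR 1 * expR (-1))); last by rewrite /c; ring.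
    by rewrite -expRD subrr expR0 mulr1.
  rewrite ler_pdivlMr//.
  have invpow t : (n.+1%:R^-1 : R) `^ t = (n.+1%:R `^ t)^-1.
    by rewrite -powR_inv1 ?ler0n// -powRrM mulN1r powRN.
  have nE : n.+1%:R `^ (rho1 + 1) = n.+1%:R * n.+1%:R `^ rho1 :> R.
    rewrite powRD; last by rewrite (gt_eqF n0) implybT.
    by rewrite (powRr1 (ltW n0)) mulrC.
  have [t1|/ltW t1] := leP 1 (enorm x / n.+1%:R).
    rewrite Q_ge1// powRM ?(ltW x0) ?invr_ge0// invpow.
    rewrite [leRHS](_ : _ = kappa * z / n.+1%:R `^ rho); last by rewrite /z; ring.
    rewrite ler_pdivlMr ?powR_gt0//.
    apply: le_trans h; rewrite -mulrA ler_pM2l ?expR_gt0//.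
    rewrite nE ler_pM2l//; apply: ler_powR => //.
    by rewrite ler1n.
  rewrite Q_le1// powRM ?(ltW x0) ?invr_ge0// invpow.
  rewrite [leRHS](_ : _ = kappa * (lambda * enorm x `^ rho1) / n.+1%:R `^ rho1); last by ring.
  rewrite ler_pdivlMr ?powR_gt0// -mulrA.
  rewrite -nE; apply: le_trans h _.
  rewrite ler_pM2l ?kappa_gt0// /z ler_pM2l//; exact: ler_powR.
have Q0 : 0 <= Q (enorm x / n.+1%:R).
  by apply: Q_ge0; rewrite divr_gt0.
apply: (@le_trans _ _ ((lambda ^+ n.+1 / n.+1`!%:R)%:E *
   (Q (enorm x / n.+1%:R) ^+ n.+1 * T)%:E)%E); last first.
  apply: lee_wpmul2l; last exact: conv_pow_lower.
  by rewrite lee_fin divr_ge0// exprn_ge0// ltW.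
rewrite -EFinM lee_fin (mulrA (lambda ^+ n.+1 / _)); apply: ler_wpM2r => //.
apply: (@le_trans _ _ (expR 1 ^+ n.+1)).
  rewrite -expRM_natl -expRD ler_expR mulr1 -(natr1 n.+1) in n2 *; lra.
apply: (@le_trans _ _ ((lambda * Q (enorm x / n.+1%:R) / n.+1%:R) ^+ n.+1)).
  have lQ : 0 <= lambda * Q (enorm x / n.+1%:R) / n.+1%:R.
    by apply: le_trans key; exact: expR_ge0.
  by apply: lerXn2r; rewrite ?nnegrE ?expR_ge0.
rewrite expr_div_n exprMn [leRHS]mulrAC; apply: ler_wpM2l.
  by apply: mulr_ge0; rewrite exprn_ge0// ltW.
rewrite lef_pV2 ?posrE ?exprn_gt0 ?ltr0n ?fact_gt0// -natrX ler_nat.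
exact: fact_le_expn.
Qed.
(** A zero mass would make the second convolution power vanish, by [conv_pow_le],
    whereas it is positive by [conv_pow_lower].  At |x| = 2 the two steps have
    length exactly 1. *)
Lemma mass_gt0 (L : R) (x : Rn R d) : enorm x = 2 ->
  (forall s u, 0 < s -> s <= enorm u -> f u <= s `^ (- g)) ->
  (\int[@lebesgue_Rn R d]_u (f u)%:E = L%:E)%E -> 0 < L.
Proof.
move=> x2 fB fL; rewrite lt_neqAle; apply/andP; split; last first.
  by rewrite -lee_fin -fL; apply: integral_ge0 => u _; rewrite lee_fin.
apply/negP => /eqP L0.
have x1 : 1 <= enorm x by rewrite x2 ler1n.
have := conv_pow_le mf f0 fL (fun s _ => powR_ge0 s (- g)) fB 1
  (lt_le_trans ltr01 x1) (lexx (enorm x)).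
rewrite -L0 expr1 mulr0 => h; have := le_trans (conv_pow_lower 1 x1) h.
rewrite lee_fin leNgt x2 divff// Q_ge1// powR1 mulr1.
by rewrite !mulr_gt0 ?exprn_gt0 ?kappa_gt0 ?expR_gt0 ?powR_gt0.
Qed.

End LowerBound.

(** * The two-sided estimate *)

Section Quotients.
Context {R : realType}.
Implicit Types (B c w : R) (S : \bar R).

Lemma le_cancel_quot B c w S : 0 < c -> 0 < w -> ((B * w)%:E <= S)%E ->
  (B%:E <= c%:E * S / (c * w)%:E)%E.
Proof.
move=> c0 w0 BS; have cw : 0 < c * w by rewrite mulr_gt0.
rewrite inver (gt_eqF cw) lee_pdivlMr// -EFinM.
rewrite (_ : B * (c * w) = c * (B * w)); last by ring.
by rewrite EFinM lee_wpmul2l// lee_fin ltW.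
Qed.

Lemma cancel_quot_le B c w S : 0 < c -> 0 < w -> (S <= (B * w)%:E)%E ->
  (c%:E * S / (c * w)%:E <= B%:E)%E.
Proof.
move=> c0 w0 BS; have cw : 0 < c * w by rewrite mulr_gt0.
rewrite inver (gt_eqF cw) lee_pdivrMr// -EFinM.
rewrite (_ : B * (c * w) = c * (B * w)); last by ring.
by rewrite EFinM lee_wpmul2l// lee_fin ltW.
Qed.

Lemma exists_enorm d' (a : R) : 0 <= a -> exists x : Rn R d'.+1, enorm x = a.
Proof.
move=> a0; exists [tuple if i == ord0 then a else 0 | i < d'.+1].
rewrite -[RHS](ger0_norm a0) -sqrtr_sqr; congr Num.sqrt.
rewrite (bigD1 ord0)//= tnth_mktuple eqxx big1 ?addr0// => i i0.
by rewrite tnth_mktuple (negbTE i0) expr0n.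
Qed.

End Quotients.

Theorem corollary4p11 (R : realType) (d : nat) (m gamma : R)
    (g : R -> R) (rho1 : R)
    (hd : (1 <= d)%N) (hm : 0 < m)
    (hgamma0 : 0 <= gamma) (hgamma : gamma < (d%:R + 1) / 2)
    (hg : (g = (fun r => r `^ (- gamma)) /\ rho1 = d%:R - gamma) \/
          (g = (fun r => (Num.max 1 r) `^ (- gamma)) /\ rho1 = d%:R)) :
  let rho2 := (d%:R + 1) / 2 - gamma in
  let f := fun x : Rn R d => expR (- m * enorm x) * g (enorm x) in
  forall (C1 C2 : R) (hC1 : 1 <= C1) (hC2 : 1 <= C2)
    (hfC1 : forall x y : Rn R d, 1 <= enorm x -> enorm x <= enorm y ->
       enorm y <= enorm x + 1 -> f x <= C1 * f y)
    (hfC2 : forall x : Rn R d, enorm x <= 1 -> f x <= C2 * f (scaleRn 2 x)),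
  let M2 := Num.max C1 C2 * L1norm f in
  exists E1 E2 E3 E4 E5 E6 : R,
    [/\ 0 < E1, 0 < E2 & 0 < E3] /\ [/\ 0 < E4, 0 < E5 & 0 < E6] /\
    forall (x : Rn R d) (lambda : R), 1 <= enorm x -> 0 < lambda ->
      (lambda * enorm x `^ ((d%:R + 1) / 2 - gamma) <= 1 ->
        (E1%:E <=
         cpoisson_density f lambda x /
           (lambda * expR (- lambda * L1norm f) * expR (- m * enorm x) *
            enorm x `^ (- gamma))%:E
         <= E2%:E)%E) /\
      (1 <= lambda * enorm x `^ ((d%:R + 1) / 2 - gamma) ->
        ((E3 * expR (E4 * (lambda * enorm x `^ ((d%:R + 1) / 2 - gamma))
                            `^ (1 / (rho1 + 1))))%:E <=
         cpoisson_density f lambda x /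
           (expR (- lambda * L1norm f) * expR (- m * enorm x) *
            enorm x `^ (- ((d%:R + 1) / 2)))%:E
         <= (E5 * expR (lambda * M2) *
             expR (E6 * (lambda * enorm x `^ ((d%:R + 1) / 2 - gamma))
                          `^ (1 / (rho2 + 1))))%:E)%E).
Proof.
case: d hd hgamma hg => // d' _ hgamma hg rho2 f C1 C2 hC1 hC2 hfC1 hfC2 M2.
set rho := (d'.+1%:R + 1) / 2 - gamma in rho2 *.
have mg : measurable_fun setT g.
  case: hg => -[-> _]; first exact: measurable_powR.
  apply: (@measurableT_comp _ _ _ _ _ _ (fun r : R => r `^ (- gamma))).
    exact: measurable_powR.
  exact: measurable_maxr.
have mf : measurable_fun setT f.
  apply: measurable_funM; last exact: (measurableT_comp mg measurable_enorm).
  apply: (@measurableT_comp _ _ _ _ _ _ (@expR R)); first exact: measurable_expR.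
  by apply: measurable_funM => //; exact: measurable_enorm.
have g0 r : 0 <= g r by case: hg => -[-> _]; exact: powR_ge0.
have f0 u : 0 <= f u by rewrite mulr_ge0 ?expR_ge0.
have g1 r : 1 <= r -> g r = r `^ (- gamma).
  by move=> r1; case: hg => -[-> _] //; rewrite (max_idPr r1).
have gle r : 0 < r -> g r <= r `^ (- gamma).
  move=> r0; case: hg => -[-> _] //; apply: powRN_anti => //.
  by rewrite le_max lexx orbT.
have gz : g 0 <= 1.
  case: hg => -[-> _]; last by rewrite (max_idPl _) ?powR1.
  by rewrite /powR eqxx lern1 leq_b1.
have gsmall t : 0 < t -> t <= 1 -> g t = t `^ (rho1 - d'.+1%:R).
  move=> t0 t1; case: hg => -[-> ->]; first by congr (_ `^ _); ring.
  by rewrite (max_idPl t1) powR1 subrr powRr0.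
have g2 t r : 0 < t -> t / 2 <= r -> r <= 2 * t -> 2 `^ (- gamma) * g t <= g r.
  move=> t0 tr rt; have r0 : 0 < r by apply: lt_le_trans tr; rewrite divr_gt0.
  case: hg => -[-> _]; rewrite -powRM ?le_max ?ler01 ?(ltW t0)//.
    exact: powRN_anti.
  apply: powRN_anti => //; first by rewrite lt_max ltr01.
  rewrite ge_max; apply/andP; split.
    by apply: (@le_trans _ _ (2 * 1)); [lra|rewrite ler_pM2l// le_max lexx].
  by apply: le_trans rt _; rewrite ler_pM2l// le_max lexx orbT.
have rho1P : rho <= rho1.
  have : 1 <= d'.+1%:R :> R by rewrite ler1n.
  by rewrite /rho; case: hg => -[_ ->]; lra.
have fle u : 0 < enorm u -> f u <= expR (- m * enorm u) * enorm u `^ (- gamma).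
  by move=> u0; apply: ler_wpM2l; [exact: expR_ge0|exact: gle].
have fz u : enorm u = 0 -> f u <= 1.
  by move=> u0; rewrite /f u0 mulr0 expR0 mul1r.
have f1 u : 1 <= enorm u -> f u = expR (- m * enorm u) * enorm u `^ (- gamma).
  by move=> u1; rewrite /f g1.
have f2 t u : 0 < t -> t / 2 <= enorm u -> enorm u <= 2 * t ->
    2 `^ (- gamma) * g t * expR (- m * enorm u) <= f u.
  by move=> t0 t1 t2; rewrite /f mulrC ler_wpM2l ?expR_ge0// g2.
have fB s u : 0 < s -> s <= enorm u -> f u <= s `^ (- gamma).
  move=> s0 su; have u0 := lt_le_trans s0 su.
  apply: le_trans (powRN_anti hgamma0 s0 su); apply: le_trans (fle u u0) _.
  by rewrite ler_piMl ?powR_ge0// expR_le1 mulNr oppr_le0 mulr_ge0 ?ltW.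
have [e1 e1E] := @exists_enorm R d' 1 ler01.
have [e2 e2E] := @exists_enorm R d' 2 (ler0n _ _).
have [L fL] : exists L, (\int[lebesgue_Rn d'.+1]_u (f u)%:E = L%:E)%E.
  have [C C0 CP] := tilted_mass hm hgamma0 hgamma.
  have [L LE _] := mass_finite f0 (CP f e1 m mf f0 fle fz e1E hm (lexx m)).
  exists L; rewrite -LE; apply: eq_integral => u _.
  by rewrite subrr mul0r expR0 mulr1.
have L0 : 0 < L := mass_gt0 hm mf f0 f2 g1 gsmall e2E fB fL.
have L1 : L1norm f = L by exact: L1normE.
(* Comparing f at distances 1 and 2 from the origin gives C1 >= exp m. *)
have C1gt1 : 1 < C1.
  have := hfC1 e1 e2; rewrite e1E e2E => /(_ (lexx _) ltac:(lra) ltac:(lra)).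
  rewrite !f1 ?e1E ?e2E ?ler1n// powR1 !mulr1 => h.
  have h2 : expR (- m) <= C1 * expR (- m * 2).
    apply: le_trans h _; apply: ler_wpM2l; first lra.
    rewrite ler_piMr ?expR_ge0//; apply: (@le_trans _ _ (2 `^ 0)); last by rewrite powRr0.
    by apply: ler_powR; rewrite ?ler1n ?oppr_le0.
  apply: (@lt_le_trans _ _ (expR m)); first by rewrite expR_gt1.
  rewrite -(ler_pM2r (expR_gt0 (- m * 2))) -expRD.
  by rewrite (_ : m + - m * 2 = - m)//; ring.
have a1 : 1 < Num.max C1 C2 by rewrite lt_max C1gt1.
have [E2 E20 E2P] := poisson_series_upper_small hm hgamma0 hgamma mf f0 fle fz.
have [E5 [E6 [E50 E60 E56P]]] :=
  poisson_series_upper_large hm hgamma0 hgamma mf f0 fle fz fL L0 a1.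
have [E4 E40 E4P] :=
  poisson_series_lower hm hgamma mf f0 rho1P f2 g1 gsmall f1.
exists 1, E2, (expR (-1)), E4, E5, E6.
split; first by split; rewrite ?expR_gt0.
split=> //; move=> x lambda x1 l0; have x0 : 0 < enorm x by lra.
rewrite /M2 L1.
have dE : cpoisson_density f lambda x =
  ((expR (- lambda * L))%:E * poisson_series f lambda x)%E by rewrite -L1.
rewrite dE; set c := expR (- lambda * L).
have c0 : 0 < c by exact: expR_gt0.
split=> z1.
- rewrite (_ : lambda * c * _ * _ = c * (lambda * expR (- m * enorm x) *
    enorm x `^ (- gamma))); last by ring.
  have w0 : 0 < lambda * expR (- m * enorm x) * enorm x `^ (- gamma).
    by rewrite !mulr_gt0 ?expR_gt0 ?powR_gt0.
  apply/andP; split; last by apply: cancel_quot_le => //; exact: E2P.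
  apply: le_cancel_quot => //.
  apply: le_trans (poisson_series_ge_term x 0 f0 (ltW l0)).
  by rewrite /conv_pow /= divr1 expr1 f1// -EFinM mul1r mulrA.
- have w0 : 0 < expR (- m * enorm x) * enorm x `^ (- ((d'.+1%:R + 1) / 2)).
    by rewrite !mulr_gt0 ?expR_gt0 ?powR_gt0.
  rewrite -(mulrA c); apply/andP; split.
    by apply: le_cancel_quot => //; exact: E4P.
  by apply: cancel_quot_le => //; exact: E56P.
Qed.
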